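(* Let $\mathcal{L}$ be a finite spherical congruence-uniform lattice with the intersection property. Then for every lattice congruence $\Theta$ of $\mathcal{L}$, the core label order of the quotient lattice $\mathcal{L}/\Theta$ is a lattice.
   Context: For a finite lattice $\mathcal{L}=(L,\leq)$, $\mathcal{J}(\mathcal{L})$ denotes the set of join-irreducible elements; each $j\in\mathcal{J}(\mathcal{L})$ has a unique lower cover $j_*$. For a cover relation $u\lessdot v$, $\mathrm{cg}(u,v)$ is the finest lattice congruence in which $u,v$ are equivalent, and $\mathrm{cg}(j)=\mathrm{cg}(j_*,j)$; the join-irreducible elements of the congruence lattice are exactly the $\mathrm{cg}(j)$. A finite lattice is congruence-uniform if $j\mapsto\mathrm{cg}(j)$ is a bijection from $\mathcal{J}(\mathcal{L})$ onto the join-irreducible congruences, for both $\mathcal{L}$ and its dual. (Quotients of congruence-uniform lattices are congruence-uniform.) For a cover $u\lessdot v$, $j_{\mathrm{cg}(u,v)}$ denotes the unique $j\in\mathcal{J}(\mathcal{L})$ with $\mathrm{cg}(j)=\mathrm{cg}(u,v)$. The nucleus of $x$ is $x_\downarrow=\bigwedge\{y\mid y\lessdot x\}$; the core label set is $\Psi(x)=\{j_{\mathrm{cg}(u,v)}\mid x_\downarrow\le u\lessdot v\le x\}$ (empty for $x=\hat0$). The core label order is $(L,\sqsubseteq)$ with $x\sqsubseteq y$ iff $\Psi(x)\subseteq\Psi(y)$. $\mathcal{L}$ has the intersection property if for all $x,y\in L$ there exists $z\in L$ with $\Psi(x)\cap\Psi(y)=\Psi(z)$. A bounded poset is spherical if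 the order complex of its proper part (with $\hat0,\hat1$ removed) is homotopy equivalent to a sphere. *)

(* Defs.v *)
From HB Require Import structures.
From mathcomp Require Import all_boot all_order all_algebra.
From mathcomp Require Import generic_quotient.
From mathcomp Require Import boolp classical_sets functions reals.
From mathcomp Require Import topology normedtype.

Set Implicit Arguments.
Unset Strict Implicit.
Unset Printing Implicit Defensive.

Import Order.TTheory GRing.Theory Num.Theory.
Import numFieldNormedType.Exports.

Local Open Scope order_scope.
Local Open Scope set_scope.

Definition covers d (L : finPOrderType d) (u v : L) : bool :=
  (u < v) && ~~ [exists w : L, (u < w) && (w < v)].

Definition join_irreducible d (L : finTBLatticeType d) (j : L) : bool :=
  (j != \bot) &&
  [forall a : L, forall b : L, (j == a `|` b) ==> ((j == a) || (j == b))].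

Definition JI d (L : finTBLatticeType d) : {set L} :=
  [set j : L | join_irreducible j].

(* For j join-irreducible, this is the unique lower cover j_* of j; the default
   value j is only reached for j = \bot. *)
Definition lower_cover d (L : finTBLatticeType d) (j : L) : L :=
  odflt j [pick y : L | covers y j].

Section Congruences.
Variables (d : Order.disp_t) (L : finTBLatticeType d).

Definition is_congruence (E : {set L * L}) : bool :=
  [&& [forall x : L, (x, x) \in E],
      [forall x : L, forall y : L, ((x, y) \in E) ==> ((y, x) \in E)],
      [forall x : L, forall y : L, forall z : L,
         ((x, y) \in E) ==> ((y, z) \in E) ==> ((x, z) \in E)] &
      [forall x : L, forall x' : L, forall y : L, forall y' : L,
         ((x, x') \in E) ==> ((y, y') \in E) ==>
         ((x `&` y, x' `&` y') \in E) && ((x `|` y, x' `|` y') \in E)]].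

Record congruence :=
  Congruence { congr_set :> {set L * L}; _ : is_congruence congr_set }.

HB.instance Definition _ := [isSub for congr_set].
HB.instance Definition _ := [Finite of congruence by <:].

Definition congr_rel (T : congruence) : rel L := 
  fun x y => (x, y) \in congr_set T.

Lemma is_congruenceP (E : {set L * L}) :
  reflect [/\ forall x, (x, x) \in E,
              forall x y, (x, y) \in E -> (y, x) \in E,
              forall x y z, (x, y) \in E -> (y, z) \in E -> (x, z) \in E &
              forall x x' y y', (x, x') \in E -> (y, y') \in E ->
                (x `&` y, x' `&` y') \in E /\ (x `|` y, x' `|` y') \in E]
          (is_congruence E).
Proof.
apply: (iffP and4P) => -[r s t m]; split.
- exact/forallP.
- by move=> x y; move/forallP/(_ x)/forallP/(_ y)/implyP: s.
- move=> x y z xy yz.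
  by move/forallP/(_ x)/forallP/(_ y)/forallP/(_ z): t; rewrite xy yz.
- move=> x x' y y' xx yy.
  move/forallP/(_ x)/forallP/(_ x')/forallP/(_ y)/forallP/(_ y'): m.
  by rewrite xx yy => /andP.
- exact/forallP.
- by apply/forallP => x; apply/forallP => y; apply/implyP; exact: s.
- apply/forallP => x; apply/forallP => y; apply/forallP => z.
  by apply/implyP => xy; apply/implyP; exact: t xy.
- apply/forallP => x; apply/forallP => x'; apply/forallP => y.
  apply/forallP => y'; apply/implyP => xx; apply/implyP => yy; apply/andP.
  exact: m.
Qed.

Lemma congr_setP (T : congruence) : is_congruence T.
Proof. by case: T. Qed.

Lemma congr_refl (T : congruence) : reflexive (congr_rel T).
Proof. by case/is_congruenceP: (congr_setP T). Qed.

Lemma congr_sym (T : congruence) : symmetric (congr_rel T).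
Proof.
case/is_congruenceP: (congr_setP T) => _ s _ _ x y.
by apply/idP/idP; exact: s.
Qed.

Lemma congr_trans (T : congruence) : transitive (congr_rel T).
Proof.
by case/is_congruenceP: (congr_setP T) => _ _ t _ y x z; exact: t.
Qed.

Lemma congr_meet (T : congruence) (x x' y y' : L) :
  congr_rel T x x' -> congr_rel T y y' -> congr_rel T (x `&` y) (x' `&` y').
Proof.
case/is_congruenceP: (congr_setP T) => _ _ _ m h h'.
by have [] := m _ _ _ _ h h'.
Qed.

Lemma congr_join (T : congruence) (x x' y y' : L) :
  congr_rel T x x' -> congr_rel T y y' -> congr_rel T (x `|` y) (x' `|` y').
Proof.
case/is_congruenceP: (congr_setP T) => _ _ _ m h h'.
by have [] := m _ _ _ _ h h'.
Qed.

Lemma bigcap_congr (P : pred congruence) :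
  is_congruence (\bigcap_(T : congruence | P T) congr_set T).
Proof.
apply/is_congruenceP; split.
- by move=> x; apply/finset.bigcapP => T _; exact: congr_refl.
- move=> x y /finset.bigcapP xy; apply/finset.bigcapP => T PT.
  by have := xy T PT; rewrite -!/(congr_rel T _ _) congr_sym.
- move=> x y z /finset.bigcapP xy /finset.bigcapP yz; apply/finset.bigcapP => T PT.
  exact: congr_trans (xy T PT) (yz T PT).
- move=> x x' y y' /finset.bigcapP xx /finset.bigcapP yy; split; apply/finset.bigcapP => T PT.
    exact: congr_meet (xx T PT) (yy T PT).
  exact: congr_join (xx T PT) (yy T PT).
Qed.

Definition congr_inf (P : pred congruence) : congruence :=
  Congruence (bigcap_congr P).

Definition congr_le (T U : congruence) : bool := congr_set T \subset congr_set U.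

Fact congr_le_refl : reflexive congr_le.
Proof. by move=> T; exact: subxx. Qed.

Fact congr_le_anti : antisymmetric congr_le.
Proof. by move=> T U TU; apply: val_inj; apply/eqP; rewrite finset.eqEsubset. Qed.

Fact congr_le_trans : transitive congr_le.
Proof. by move=> T U V; exact: fintype.subset_trans. Qed.

HB.instance Definition _ := Order.Le_isPOrder.Build d congruence
  congr_le_refl congr_le_anti congr_le_trans.

Definition congr_I (T U : congruence) : congruence :=
  congr_inf [pred V | (V == T) || (V == U)].

Definition congr_U (T U : congruence) : congruence :=
  congr_inf [pred V | congr_le T V && congr_le U V].

Fact congr_IP (T U V : congruence) :
  congr_le T (congr_I U V) = congr_le T U && congr_le T V.
Proof.
apply/finset.bigcapsP/andP => [h|[TU TV] W /orP[] /eqP -> //].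
by split; apply: h; rewrite /= eqxx ?orbT.
Qed.

Fact congr_UP (T U V : congruence) :
  congr_le (congr_U T U) V = congr_le T V && congr_le U V.
Proof.
apply/idP/idP => [h|h]; last exact: finset.bigcap_inf.
apply/andP; split; apply: fintype.subset_trans h; apply/finset.bigcapsP => W /andP[] //.
Qed.

HB.instance Definition _ := Order.POrder_MeetJoin_isLattice.Build d congruence
  congr_IP congr_UP.

Fact congr_0P (T : congruence) : congr_le (congr_inf predT) T.
Proof. exact: finset.bigcap_inf. Qed.

Fact congr_1P (T : congruence) : congr_le T (congr_inf pred0).
Proof. exact/finset.bigcapsP. Qed.

HB.instance Definition _ := Order.hasBottom.Build d congruence congr_0P.
HB.instance Definition _ := Order.hasTop.Build d congruence congr_1P.

Definition cg (u v : L) : congruence := congr_inf [pred T | congr_rel T u v].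

Definition cgJ (j : L) : congruence := cg (lower_cover j) j.

End Congruences.

Arguments congruence {d} L.

Section Quotient.
Variables (d : Order.disp_t) (L : finTBLatticeType d) (T : congruence L).

Canonical congr_equiv :=
  EquivRel (congr_rel T) (congr_refl T) (congr_sym T) (@congr_trans d L T).

Definition quot := {eq_quot congr_equiv}%qT.

HB.instance Definition _ := Choice.on quot.
HB.instance Definition _ := EqQuotient.on quot.
HB.instance Definition _ := Finite.copy quot
  (can_type (EquivQuot.ereprK : cancel _ (_ : L -> {eq_quot congr_equiv}%qT))).

Local Notation pi := (\pi_quot : L -> quot)%qT.

Definition quot_meet (x y : quot) : quot := pi (repr x `&` repr y).
Definition quot_join (x y : quot) : quot := pi (repr x `|` repr y).
Definition quot_le (x y : quot) : bool := quot_meet x y == x.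

Lemma quot_piP (x y : L) : (pi x == pi y) = congr_rel T x y.
Proof. by rewrite piE. Qed.

Lemma quot_repr_pi (x : L) : congr_rel T (repr (pi x)) x.
Proof. by rewrite -quot_piP reprK. Qed.

Lemma pi_meet (x y : L) : pi (x `&` y) = quot_meet (pi x) (pi y).
Proof.
apply/eqP; rewrite quot_piP congr_sym.
by apply: congr_meet; exact: quot_repr_pi.
Qed.

Lemma pi_join (x y : L) : pi (x `|` y) = quot_join (pi x) (pi y).
Proof.
apply/eqP; rewrite quot_piP congr_sym.
by apply: congr_join; exact: quot_repr_pi.
Qed.

Lemma pi_ind (P : quot -> Prop) : (forall x : L, P (pi x)) -> forall x, P x.
Proof. by move=> h x; rewrite -[x]reprK. Qed.

Fact quot_meetC : commutative quot_meet.
Proof. by move=> x y; rewrite /quot_meet meetC. Qed.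

Fact quot_joinC : commutative quot_join.
Proof. by move=> x y; rewrite /quot_join joinC. Qed.

Fact quot_meetA : associative quot_meet.
Proof.
elim/pi_ind=> x; elim/pi_ind=> y; elim/pi_ind=> z.
by rewrite -!pi_meet meetA.
Qed.

Fact quot_joinA : associative quot_join.
Proof.
elim/pi_ind=> x; elim/pi_ind=> y; elim/pi_ind=> z.
by rewrite -!pi_join joinA.
Qed.

Fact quot_joinKI (y x : quot) : quot_meet x (quot_join x y) = x.
Proof.
elim/pi_ind: x => x; elim/pi_ind: y => y.
by rewrite -pi_join -pi_meet joinKI.
Qed.

Fact quot_meetKU (y x : quot) : quot_join x (quot_meet x y) = x.
Proof.
elim/pi_ind: x => x; elim/pi_ind: y => y.
by rewrite -pi_meet -pi_join meetKU.
Qed.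

Fact quot_le_refl : reflexive quot_le.
Proof. by elim/pi_ind=> x; rewrite /quot_le -pi_meet meetxx. Qed.

Fact quot_le_anti : antisymmetric quot_le.
Proof.
by move=> x y /andP[/eqP xy /eqP yx]; rewrite -xy quot_meetC.
Qed.

Fact quot_le_trans : transitive quot_le.
Proof.
move=> y x z /eqP xy /eqP yz; apply/eqP.
by rewrite -xy -quot_meetA yz.
Qed.

HB.instance Definition _ := Order.Le_isPOrder.Build d quot
  quot_le_refl quot_le_anti quot_le_trans.

HB.instance Definition _ := Order.POrder_isLattice.Build d quot
  quot_meetC quot_joinC quot_meetA quot_joinA quot_joinKI quot_meetKU
  (fun _ _ => erefl).

Fact quot_0P (x : quot) : quot_le (pi \bot) x.
Proof. by elim/pi_ind: x => x; rewrite /quot_le -pi_meet meet0x. Qed.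

Fact quot_1P (x : quot) : quot_le x (pi \top).
Proof. by elim/pi_ind: x => x; rewrite /quot_le -pi_meet meetx1. Qed.

HB.instance Definition _ := Order.hasBottom.Build d quot quot_0P.
HB.instance Definition _ := Order.hasTop.Build d quot quot_1P.

End Quotient.

Definition cg_bijective d (L : finTBLatticeType d) : Prop :=
  {in JI L &, injective (@cgJ d L)} /\
  [set cgJ j | j in JI L] = JI (congruence L).

Definition congruence_uniform d (L : finTBLatticeType d) : Prop :=
  cg_bijective L /\ cg_bijective (L^d : finTBLatticeType _).

Definition nucleus d (L : finTBLatticeType d) (x : L) : L :=
  \meet_(y : L | covers y x) y.

(* j ranges over the join-irreducibles labelling the cover u <. v, i.e. such
   that cg(j) = cg(u,v); in a congruence-uniform lattice there is exactly one.
   For x = \bot the nucleus is the empty meet \top and the set is empty. *)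
Definition core_label_set d (L : finTBLatticeType d) (x : L) : {set L} :=
  [set j in JI L |
    [exists u : L, exists v : L,
      [&& nucleus x <= u, covers u v, v <= x & cgJ j == cg u v]]].

Definition core_label_order d (L : finTBLatticeType d) : rel L :=
  fun x y => core_label_set x \subset core_label_set y.

Arguments core_label_order {d} L.

Definition intersection_property d (L : finTBLatticeType d) : Prop :=
  forall x y : L, exists z : L,
    core_label_set x :&: core_label_set y = core_label_set z.

Definition is_lattice (T : Type) (r : rel T) : Prop :=
  [/\ reflexive r, antisymmetric r, transitive r,
      forall x y, exists m, forall z, r z m = r z x && r z y &
      forall x y, exists s, forall z, r s z = r x z && r y z].

Local Open Scope classical_set_scope.
Local Open Scope ring_scope.

Definition homotopic (R : realType) (X Y : topologicalType) (f g : X -> Y) :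
  Prop :=
  exists H : X * R -> Y,
    [/\ {within [set: X] `*` `[0, 1], continuous H},
        forall x, H (x, 0) = f x &
        forall x, H (x, 1) = g x].

Definition homotopy_equivalent (R : realType) (X Y : topologicalType) : Prop :=
  exists (f : X -> Y) (g : Y -> X),
    [/\ continuous f, continuous g,
        homotopic R (g \o f) idfun & homotopic R (f \o g) idfun].

(* The unit sphere S^(n-1) of R^n; for n = 0 this is the empty sphere S^(-1). *)
Definition unit_sphere (R : realType) (n : nat) : set 'rV[R]_n :=
  [set x | \sum_(i < n) x ord0 i ^+ 2 = 1].

Arguments unit_sphere : clear implicits.

Definition order_complex d (P : finPOrderType d) (A : {set P}) : {set {set P}} :=
  [set C : {set P} | (C \subset A) &&
    [forall x in C, forall y in C, (x >=< y)%O]]%SET.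

(* Barycentric coordinates, in R^V with the product topology. *)
Definition geometric_realization (R : realType) (V : finType)
    (K : {set {set V}}) : set {ptws V -> R} :=
  [set t | [/\ forall v, 0 <= t v, \sum_v t v = 1 &
               [set v | t v != 0]%SET \in K]].

Arguments geometric_realization R {V} K.

Definition proper_part d (L : finTBLatticeType d) : {set L} :=
  [set x : L | (x != \bot%O) && (x != \top%O)]%SET.

Definition spherical (R : realType) d (L : finTBLatticeType d) : Prop :=
  exists n : nat,
    homotopy_equivalent R
      (set_type (geometric_realization R (order_complex (proper_part L))))
      (set_type (unit_sphere R n)).

(* Main.v *)
(** Write Q for the quotient lattice and "uncontracted" for the join-irreducibles
    j of L that are not congruent to their lower cover.  Because the congruence
    of a cover is join-prime, Q inherits the injectivity of j |-> cg(j) on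
    join-irreducibles, and for x least in its class the core labels of x in Q
    are the images of the uncontracted core labels of x in L.  Every element is
    the join of its core labels, so the core label order of Q is antisymmetric.

    For the intersection property of Q, let z be minimal among the elements of
    L with a prescribed set of uncontracted core labels.  If z were not least
    in its class, the least element m of its class in [z_down, z] would still
    carry all these labels, and an element t whose label set is the
    intersection of those of z and m would satisfy t <= m < z with the same
    uncontracted labels.  So z is least in its class.

    Meets together with a greatest element give a lattice; the greatest element
    exists once the coatoms of L meet in the bottom element, a property that
    passes to Q.  If they met in b <> \bot, then x <= x \/ b >= b would contract
    the order complex of the proper part, hence a sphere.  Spheres are not
    contractible by the Poincare-Miranda theorem, which follows from Kuhn's
    labelling lemma; the latter is Stokes' theorem mod 2 applied to the cup
    product of the coboundaries of the labels. *)

Require Import Defs.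
From mathcomp Require Import all_boot all_order all_algebra generic_quotient reals.

Set Implicit Arguments.
Unset Strict Implicit.
Unset Printing Implicit Defensive.

Import Order.TTheory.

(** * Core labels and lattice quotients *)

Section Extremal.
Local Open Scope order_scope.
Variables (d : Order.disp_t) (L : finPOrderType d).

Lemma exists_minimal (P : pred L) (x0 : L) : P x0 ->
  exists x, P x /\ forall y, P y -> y <= x -> y = x.
Proof.
move=> Px0; case: (arg_minnP (fun x => #|[set y | y <= x]|) Px0) => x Px minx.
exists x; split=> // y Py yx; apply/eqP; rewrite eq_le yx /=.
have sub : [set t | t <= y] \subset [set t | t <= x].
  by apply/subsetP => t; rewrite !inE => /le_trans; apply.
have /eqP e : [set t | t <= y] == [set t | t <= x].
  by rewrite eqEcard sub minx.
have : x \in [set t | t <= x] by rewrite inE.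
by rewrite -e inE.
Qed.

Lemma exists_maximal (P : pred L) (x0 : L) : P x0 ->
  exists x, P x /\ forall y, P y -> x <= y -> y = x.
Proof.
move=> Px0; case: (arg_minnP (fun x => #|[set y | x <= y]|) Px0) => x Px minx.
exists x; split=> // y Py xy; apply/eqP; rewrite eq_le xy andbT.
have sub : [set t | y <= t] \subset [set t | x <= t].
  by apply/subsetP => t; rewrite !inE; apply: le_trans.
have /eqP e : [set t | y <= t] == [set t | x <= t].
  by rewrite eqEcard sub minx.
have : x \in [set t | x <= t] by rewrite inE.
by rewrite -e inE.
Qed.

Lemma coversP (u v : L) :
  reflect (u < v /\ forall w, u <= w -> w <= v -> w = u \/ w = v) (covers u v).
Proof.
apply: (iffP andP) => -[uv h]; split=> //.
- move=> w uw wv; case: (eqVneq w u) => [|wu]; first by left.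
  case: (eqVneq w v) => [|wv']; first by right.
  case/existsP: h; exists w.
  by rewrite !lt_neqAle uw wv wv' (eq_sym u) wu.
- apply/existsP => -[w /andP[uw wv]].
  by case: (h w (ltW uw) (ltW wv)) => e; move: uw wv; rewrite e ltxx.
Qed.

Lemma covers_lt (u v : L) : covers u v -> u < v.
Proof. by case/andP. Qed.

Lemma exists_lower_cover (u v : L) : u < v ->
  exists w, covers w v /\ u <= w.
Proof.
move=> uv.
have [|w [/andP[uw wv] h]] := @exists_maximal [pred w | (u <= w) && (w < v)] u.
  by rewrite /= lexx.
exists w; split=> //; apply/coversP; split=> // t wt.
rewrite le_eqVlt => /orP[/eqP|tv]; [by right|left].
by apply: h; rewrite //= tv (le_trans uw).
Qed.

Lemma exists_upper_cover (u v : L) : u < v ->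
  exists w, covers u w /\ w <= v.
Proof.
move=> uv.
have [|w [/andP[uw wv] h]] := @exists_minimal [pred w | (u < w) && (w <= v)] v.
  by rewrite /= uv lexx.
exists w; split=> //; apply/coversP; split=> // t.
rewrite le_eqVlt => /orP[/eqP->|ut tw]; [by left|right].
by apply: h; rewrite //= ut (le_trans tw).
Qed.

End Extremal.

(** * Labels of covers and the core label order *)

Section Labels.
Local Open Scope order_scope.
Variables (d : Order.disp_t) (L : finTBLatticeType d).
Implicit Types (T U : congruence L) (u v x y j : L).

Lemma congr_leP T U :
  reflect (forall x y, congr_rel T x y -> congr_rel U x y) (congr_le T U).
Proof.
by apply: (iffP subsetP) => h; [move=> x y; apply: h | case=> x y; apply: h].
Qed.

Lemma cg_rel u v : congr_rel (cg u v) u v.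
Proof. exact/bigcapP. Qed.

Lemma cg_le u v T : congr_le (cg u v) T = congr_rel T u v.
Proof.
apply/idP/idP => [/congr_leP|h]; first by apply; exact: cg_rel.
exact: bigcap_inf.
Qed.

Lemma eq_cg u v u' v' :
  (forall T, congr_rel T u v = congr_rel T u' v') -> cg u v = cg u' v'.
Proof.
by move=> h; apply: congr_le_anti; rewrite !cg_le h cg_rel -h cg_rel.
Qed.

Lemma JIP j : j \in JI L ->
  covers (lower_cover j) j /\ forall y, y < j -> y <= lower_cover j.
Proof.
rewrite inE => /andP[j0 /forallP hj].
have cj : covers (lower_cover j) j.
  rewrite /lower_cover; case: pickP => //= h.
  have [|w [wj _]] := @exists_lower_cover _ L \bot j; first by rewrite lt0x.
  by rewrite h in wj.
split=> // y yj; have /coversP[aj ha] := cj.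
have ayj : lower_cover j `|` y <= j by rewrite leUx !ltW.
case: (ha _ (leUl _ y) ayj) => [<-|e]; first exact: leUr.
move/forallP: (hj (lower_cover j)) => /(_ y)/implyP; rewrite e eqxx => /(_ isT).
by case/orP => /eqP e'; move: aj yj; rewrite -e' ltxx.
Qed.

Lemma JI_unique_cover j : j != \bot ->
  (forall a b, covers a j -> covers b j -> a = b) -> j \in JI L.
Proof.
move=> j0 h; rewrite inE; apply/andP; split=> //.
apply/forallP => a; apply/forallP => b; apply/implyP => /eqP e.
have aj : a <= j by rewrite e leUl.
have bj : b <= j by rewrite e leUr.
case: (eqVneq j a) => //= ja; case: (eqVneq j b) => //= jb.
have [|a' [ca aa']] := @exists_lower_cover _ L a j.
  by rewrite lt_neqAle eq_sym ja.
have [|b' [cb bb']] := @exists_lower_cover _ L b j.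
  by rewrite lt_neqAle eq_sym jb.
have : j <= a' by rewrite e leUx aa' (h a' b').
by rewrite (lt_geF (covers_lt ca)).
Qed.

(** A minimal [j] below [v] but not below [u] is join-irreducible, and the two covers are
    perspective: [j] and [u] have join [v] and meet [lower_cover j]. So a congruence collapses one
    cover exactly when it collapses the other. *)
Lemma cover_label u v : covers u v ->
  exists j, [/\ j \in JI L, j <= v, ~~ (j <= u) & cgJ j = cg u v].
Proof.
move=> cuv; have /coversP[uv huv] := cuv.
have [|j [/andP[jv ju] hj]] := @exists_minimal _ L [pred j | (j <= v) && ~~ (j <= u)] v.
  by rewrite /= lexx lt_geF.
have below y : y < j -> y <= u.
  move=> yj; apply: contraLR (yj) => yu.
  by rewrite (hj y) ?ltxx //= ?yu ?(le_trans (ltW yj)) // ltW.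
have jJ : j \in JI L.
  rewrite inE; apply/andP; split; first by apply: contraNneq ju => ->; exact: le0x.
  apply/forallP => a; apply/forallP => b; apply/implyP => /eqP e.
  apply: contraNT ju; rewrite negb_or => /andP[ja jb].
  have au : a <= u by apply: below; rewrite lt_neqAle eq_sym ja e leUl.
  have bu : b <= u by apply: below; rewrite lt_neqAle eq_sym jb e leUr.
  by rewrite e leUx au.
exists j; split=> //; have [cj hlow] := JIP jJ.
have ju_eq : j `|` u = v.
  have juv : j `|` u <= v by rewrite leUx jv ltW.
  by case: (huv _ (leUr u j) juv) => // e; rewrite -e leUl in ju.
have ju_meet : j `&` u = lower_cover j.
  have lj := covers_lt cj.
  apply: le_anti; rewrite lexI (ltW lj) (below _ lj) !andbT.
  apply: hlow; rewrite lt_neqAle leIl andbT.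
  by apply: contraNneq ju => <-; exact: leIr.
apply: eq_cg => T; apply/idP/idP => h.
- have := congr_join h (congr_refl T u); rewrite ju_eq.
  by rewrite (join_idPr (below _ (covers_lt cj))).
- have := congr_meet h (congr_refl T j).
  by rewrite [u `&` _]meetC ju_meet [v `&` _]meetC (meet_idPl jv).
Qed.

Lemma core_labelP x j :
  reflect (j \in JI L /\ exists u v,
             [/\ nucleus x <= u, covers u v, v <= x & cgJ j = cg u v])
          (j \in core_label_set x).
Proof.
rewrite [_ \in core_label_set _]in_set; apply: (iffP andP) => -[jJ h]; split=> //.
- case/existsP: h => u /existsP[v /and4P[? ? ? /eqP ?]].
  by exists u, v.
- case: h => u [v [? ? ? ?]]; apply/existsP; exists u; apply/existsP; exists v.
  by apply/and4P; split=> //; apply/eqP.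
Qed.

Lemma nucleus_le x y : covers y x -> nucleus x <= y.
Proof. by move=> h; apply: meets_inf. Qed.

Lemma nucleus_self_le x : x != \bot -> nucleus x <= x.
Proof.
rewrite -lt0x => /exists_lower_cover[y [cy _]].
by rewrite (le_trans (nucleus_le cy)) // ltW // covers_lt.
Qed.

Section Injective.
Hypothesis cg_inj : {in JI L &, injective (@cgJ d L)}.

Lemma core_label_le x j : j \in core_label_set x -> j <= x.
Proof.
case/core_labelP => jJ [u [v [_ cuv vx e]]].
have [i [iJ iv _ ei]] := cover_label cuv.
by rewrite (cg_inj jJ iJ) ?e // (le_trans iv).
Qed.

(* x is the join of its core labels: a join strictly below x would lie below
   a lower cover of x, whose own label it dominates. *)
Lemma core_label_subset_le x y :
  core_label_set x \subset core_label_set y -> x <= y.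
Proof.
move=> /subsetP h; apply: contraT => xy.
have [|w [cw xyw]] := @exists_lower_cover _ L (x `&` y) x.
  by rewrite lt_neqAle leIl andbT; apply: contraNneq xy => <-; exact: leIr.
have [j [jJ jx jw e]] := cover_label cw.
have /h/core_label_le jy : j \in core_label_set x.
  by apply/core_labelP; split=> //; exists w, x; rewrite nucleus_le.
by case/negP: jw; apply: le_trans xyw; rewrite lexI jx jy.
Qed.

Lemma core_label_inj : injective (@core_label_set d L).
Proof.
by move=> x y e; apply: le_anti; rewrite !core_label_subset_le // e.
Qed.

End Injective.

(** The interval that defines the labels of the top is then all of [L], so each [j] is the label of
    its own cover. *)
Lemma core_label_top : nucleus (\top : L) = \bot -> core_label_set (\top : L) = JI L.
Proof.
move=> n0; apply/setP => j; apply/core_labelP/idP => [[]//|jJ].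
split=> //; exists (lower_cover j), j.
by rewrite n0 le0x lex1; case: (JIP jJ).
Qed.

Lemma core_label_order_lattice :
  {in JI L &, injective (@cgJ d L)} -> nucleus (\top : L) = \bot ->
  intersection_property L -> is_lattice (core_label_order L).
Proof.
move=> cg_inj n0 ip; rewrite /core_label_order.
have meetP (x y : L) : exists m, forall z,
    (core_label_set z \subset core_label_set m) =
    (core_label_set z \subset core_label_set x) && (core_label_set z \subset core_label_set y).
  by have [m e] := ip x y; exists m => z; rewrite -subsetI e.
split=> //.
- by move=> x y h; apply: core_label_inj => //; apply/eqP; rewrite eqEsubset.
- by move=> y x z; apply: subset_trans.
move=> x y.
(* [s] is the meet of all common upper bounds of [x] and [y], folded over the enumeration of [L]
   from the top, whose label set contains every other. *)
have [s hs] : exists s, forall z, (core_label_set z \subset core_label_set s) =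
    [forall t, (core_label_set x \subset core_label_set t) &&
      (core_label_set y \subset core_label_set t) ==>
      (core_label_set z \subset core_label_set t)].
  suff [s hs] : exists s, forall z, (core_label_set z \subset core_label_set s) =
      all (fun t => (core_label_set x \subset core_label_set t) &&
      (core_label_set y \subset core_label_set t) ==>
      (core_label_set z \subset core_label_set t)) (enum L).
    exists s => z; rewrite hs; apply/allP/forallP => [h t|h t _]; apply: h.
    by rewrite mem_enum.
  elim: (enum L) => [|t r [s IH]] /=.
    exists \top => z; rewrite core_label_top //; apply/subsetP => j.
    by case/core_labelP.
  case: (boolP (_ && _)) => _ /=; last by exists s.
  by have [m hm] := meetP t s; exists m => z; rewrite hm IH.
exists s => z; apply/idP/idP.
  have xs : core_label_set x \subset core_label_set s.
    by rewrite hs; apply/forallP => t; apply/implyP => /andP[].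
  have ys : core_label_set y \subset core_label_set s.
    by rewrite hs; apply/forallP => t; apply/implyP => /andP[].
  by move=> sz; rewrite !(subset_trans _ sz).
move=> h; have : core_label_set s \subset core_label_set s by [].
by rewrite hs => /forallP/(_ z)/implyP/(_ h).
Qed.

End Labels.

(** * Join-primeness of the congruence of a cover *)

Section JoinPrime.
Local Open Scope order_scope.
Variables (d : Order.disp_t) (L : finTBLatticeType d) (A B : congruence L).

Let step : rel L := fun x y => congr_rel A x y || congr_rel B x y.

Lemma connect_step_hom (f : L -> L) :
  {homo f : x y / congr_rel A x y} -> {homo f : x y / congr_rel B x y} ->
  {homo f : x y / connect step x y}.
Proof.
move=> fA fB x y /connectP[p]; elim: p x => [|z p IH] x /=.
  by move=> _ ->; exact: connect0.
move=> /andP[xz zp] e; apply: connect_trans (IH _ zp e); apply: connect1.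
by case/orP: xz => h; apply/orP; [left; exact: fA | right; exact: fB].
Qed.

(** Chains of steps respect meets and joins, since the two arguments can be moved one after the
    other. *)
Lemma connect_step_congruence :
  is_congruence [set p | connect step p.1 p.2].
Proof.
apply/is_congruenceP; split=> [x|x y|x y z|x x' y y']; rewrite !inE /=.
- exact: connect0.
- suff hs : connect_sym step by rewrite hs.
  apply: sym_connect_sym => a b; rewrite /step.
  by rewrite [congr_rel A _ _]congr_sym [congr_rel B _ _]congr_sym.
- exact: connect_trans.
move=> xx yy; split.
  apply: (@connect_trans _ _ (x' `&` y)).
    by apply: (@connect_step_hom (fun t => t `&` y)) xx => a b h; exact: congr_meet h (congr_refl _ _).
  by apply: (@connect_step_hom (fun t => x' `&` t)) yy => a b h; exact: congr_meet (congr_refl _ _) h.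
apply: (@connect_trans _ _ (x' `|` y)).
  by apply: (@connect_step_hom (fun t => t `|` y)) xx => a b h; exact: congr_join h (congr_refl _ _).
by apply: (@connect_step_hom (fun t => x' `|` t)) yy => a b h; exact: congr_join (congr_refl _ _) h.
Qed.

(* Retract a chain of A- and B-steps from u to v onto [u, v] = {u, v}: the step
   at which it jumps from u to v relates u and v in A or in B. *)
Lemma congrU_cover (u v : L) : covers u v ->
  congr_rel (congr_U A B) u v -> congr_rel A u v \/ congr_rel B u v.
Proof.
move=> /coversP[uv huv] h.
have {}h : connect step u v.
  have : congr_le (congr_U A B) (Congruence connect_step_congruence).
    rewrite congr_UP; apply/andP; split; apply/congr_leP => x y xy;
      rewrite /congr_rel inE /=; apply: connect1; rewrite /step xy ?orbT //.
  by move=> /congr_leP/(_ _ _ h); rewrite /congr_rel inE.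
apply/orP; apply: contraT => nAB.
pose f z := (z `|` u) `&` v.
have fuv z : f z = u \/ f z = v.
  by apply: huv; rewrite ?leIr // lexI leUr ltW.
have fu : f u = u by rewrite /f joinxx; apply/meet_idPl/ltW.
have fv : f v = v by rewrite /f (join_idPl (ltW uv)) meetxx.
have fstep x y : step x y -> f x = u -> f y = u.
  move=> xy fx; case: (fuv y) => // fy; case/negP: nAB.
  have hf (C : congruence L) : congr_rel C x y -> congr_rel C u v.
    move=> hC; rewrite -[X in congr_rel _ X]fx -fy.
    by apply: congr_meet (congr_refl _ _); apply: congr_join (congr_refl _ _).
  by case/orP: xy => /hf ->; rewrite ?orbT.
have path_u p x : path step x p -> f x = u -> f (last x p) = u.
  elim: p x => [|z p IH] x //= /andP[xz zp] fx.
  by apply: IH => //; apply: fstep xz fx.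
case/connectP: h => p pp e.
by move: (path_u _ _ pp fu) uv; rewrite -e fv => ->; rewrite ltxx.
Qed.

End JoinPrime.

(** * Core labels of a quotient lattice *)

Section QuotientLabels.
Local Open Scope order_scope.
Variables (d : Order.disp_t) (L : finTBLatticeType d) (T : congruence L).
Local Notation Q := (quot T).
Local Notation "x ~ y" := (congr_rel T x y) (at level 70).

Definition qproj (x : L) : Q := (\pi_(quot T) x)%qT.

Lemma qproj_eq (x y : L) : (qproj x == qproj y) = (x ~ y).
Proof. exact: quot_piP. Qed.

Lemma qproj_eqP (x y : L) : qproj x = qproj y <-> x ~ y.
Proof. by rewrite -qproj_eq; split=> [->//|/eqP]. Qed.

Lemma qprojI (x y : L) : qproj (x `&` y) = qproj x `&` qproj y.
Proof. exact: pi_meet. Qed.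

Lemma qprojU (x y : L) : qproj (x `|` y) = qproj x `|` qproj y.
Proof. exact: pi_join. Qed.

Lemma qproj_bot : qproj \bot = \bot. Proof. by []. Qed.

Lemma qproj_top : qproj \top = \top. Proof. by []. Qed.

Lemma qproj_surj (X : Q) : exists x, X = qproj x.
Proof. by exists (repr X); rewrite /qproj reprK. Qed.

Lemma qproj_le (x y : L) : (qproj x <= qproj y) = (x `&` y ~ x).
Proof. by rewrite -qproj_eq qprojI -leEmeet. Qed.

Lemma qproj_homo : {homo qproj : x y / x <= y}.
Proof. by move=> x y xy; rewrite qproj_le (meet_idPl xy) congr_refl. Qed.

Definition class_min (x : L) := forall y, y <= x -> y ~ x -> y = x.

Lemma class_min_exists (X : Q) : exists x, X = qproj x /\ class_min x.
Proof.
have [x ->] := qproj_surj X.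
have [|y [yx miny]] := @exists_minimal _ L [pred y | y ~ x] x.
  exact: congr_refl.
exists y; split=> [|z zy yz]; first by apply/esym/qproj_eqP.
by apply: miny => //=; apply: congr_trans yx.
Qed.

(** An element whose class lies between those of [u] and [v] can be retracted to [[u, v]] within its
    class, and so becomes [u] or [v]. *)
Lemma qproj_covers (u v : L) : covers u v -> ~~ (u ~ v) -> covers (qproj u) (qproj v).
Proof.
move=> /coversP[uv huv] nuv; apply/coversP; split.
  by rewrite lt_neqAle qproj_eq nuv qproj_homo // ltW.
move=> W; have [w ->] := qproj_surj W => uw wv.
have -> : qproj w = qproj ((w `|` u) `&` v).
  by rewrite qprojI qprojU (join_idPl uw) (meet_idPl wv).
by case: (huv ((w `|` u) `&` v)) => [||->|->]; rewrite ?leIr ?lexI ?leUr ?ltW; auto.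
Qed.

(** Take [u] maximal in [[a, b]] among the elements congruent to [a], and an upper cover [v] of [u]
    below [b]: as [v] has left the class of [a], it is in the class of [b]. *)
Lemma lift_covers (a b : L) : a <= b -> covers (qproj a) (qproj b) ->
  exists u v, [/\ covers u v, a <= u, v <= b, u ~ a & v ~ b].
Proof.
move=> ab /coversP[lab hab].
have [|u [/and3P[au ub eu] hu]] :=
  @exists_maximal _ L [pred u | [&& a <= u, u <= b & u ~ a]] a.
  by rewrite /= lexx ab congr_refl.
have [|v [cuv vb]] := @exists_upper_cover _ L u b.
  rewrite lt_neqAle ub andbT; apply: contraTneq lab => e; rewrite -e in eu *.
  by move/qproj_eqP: eu => ->; rewrite ltxx.
exists u, v; split=> //.
have av := le_trans au (ltW (covers_lt cuv)).
case: (hab (qproj v)); rewrite ?qproj_homo //; last by move/qproj_eqP.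
move/qproj_eqP => va; have := covers_lt cuv.
by rewrite (hu v) ?ltxx //= ?av ?vb ?va // ltW // covers_lt.
Qed.

(** Lift the cover to the interval from the meet of [y] and [x] up to [x]: the upper end of the lift
    is below [x] and congruent to it, so it is [x]. *)
Lemma lower_covers_class_min (x : L) (Y : Q) : class_min x ->
  covers Y (qproj x) -> exists2 y, covers y x & Y = qproj y.
Proof.
have [y ->] := qproj_surj Y => mx cY.
have e : qproj y = qproj (y `&` x).
  by rewrite qprojI (meet_idPl (ltW (covers_lt cY))).
rewrite e in cY *.
have [u [v [cuv yu vx uy ev]]] := lift_covers (leIr _ _) cY.
exists u; last by apply/qproj_eqP; rewrite congr_sym.
by rewrite (mx v vx ev) in cuv.
Qed.

Lemma class_min_lower_cover (x y : L) : class_min x -> covers y x -> ~~ (y ~ x).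
Proof.
move=> mx cy; apply/negP => yx; have := covers_lt cy.
by rewrite (mx y) ?ltxx // ltW // covers_lt.
Qed.

Lemma class_min_nucleus (x : L) : class_min x ->
  nucleus (qproj x) = qproj (nucleus x).
Proof.
move=> mx; apply: le_anti; apply/andP; split.
  rewrite (big_morph qproj qprojI qproj_top); apply: meets_ge => y cy.
  by apply: nucleus_le; apply: qproj_covers => //; exact: class_min_lower_cover.
apply: meets_ge => Y /(lower_covers_class_min mx)[y cy ->].
by apply: qproj_homo; exact: nucleus_le.
Qed.

Definition uncontracted (j : L) : bool := ~~ (lower_cover j ~ j).

Lemma cg_proj_eq (u v u' v' : L) :
  cg u v = cg u' v' -> cg (qproj u) (qproj v) = cg (qproj u') (qproj v').
Proof.
move=> e; apply: eq_cg => U.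
have cU : is_congruence [set p : L * L | congr_rel U (qproj p.1) (qproj p.2)].
  apply/is_congruenceP; split=> [x|x y|x y z|x x' y y']; rewrite !inE /=.
  - exact: congr_refl.
  - by rewrite congr_sym.
  - exact: congr_trans.
  - by move=> *; rewrite !qprojI !qprojU; split; [exact: congr_meet|exact: congr_join].
have := cg_le u v (Congruence cU).
by rewrite e cg_le /congr_rel !inE.
Qed.

(** The join [C] of [cg u' v'] and [T] descends to [Q], where it relates the images of [u'] and
    [v'], hence those of [u] and [v]. So [C] relates [u] and [v]; by join-primeness [cg u' v'] or
    [T] does, and [T] is excluded. *)
Lemma cg_proj_le (u v u' v' : L) : covers u v -> ~~ (u ~ v) ->
  cg (qproj u) (qproj v) = cg (qproj u') (qproj v') -> congr_le (cg u v) (cg u' v').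
Proof.
move=> cuv nuv e; rewrite cg_le; set C := congr_U (cg u' v') T.
have /andP[C1 C2] : congr_le (cg u' v') C && congr_le T C.
  by rewrite -congr_UP congr_le_refl.
have Crepr x : congr_rel C (repr (qproj x)) x.
  by move/congr_leP: C2; apply; exact: quot_repr_pi.
have CQ x y : congr_rel C (repr (qproj x)) (repr (qproj y)) = congr_rel C x y.
  apply/idP/idP => h.
    by apply: congr_trans (Crepr y); apply: congr_trans h; rewrite congr_sym.
  apply: congr_trans (Crepr x) _; apply: congr_trans h _.
  by rewrite congr_sym.
have cD : is_congruence [set p : Q * Q | congr_rel C (repr p.1) (repr p.2)].
  apply/is_congruenceP; split=> [X|X Y|X Y Z|X X' Y Y']; rewrite !inE /=.
  - exact: congr_refl.
  - by rewrite congr_sym.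
  - exact: congr_trans.
  - have [[x ->] [x' ->]] := (qproj_surj X, qproj_surj X').
    have [[y ->] [y' ->]] := (qproj_surj Y, qproj_surj Y').
    rewrite -!qprojI -!qprojU !CQ => xx yy.
    by split; [exact: congr_meet|exact: congr_join].
have := cg_le (qproj u) (qproj v) (Congruence cD).
rewrite e cg_le /congr_rel !inE /= -!/(congr_rel C _ _) !CQ.
rewrite (_ : congr_rel C u' v' = true); last first.
  by move/congr_leP: C1; apply; exact: cg_rel.
by move/esym/(congrU_cover cuv) => [//|h]; rewrite h in nuv.
Qed.

(** Any [y < j] lies below [lower_cover j], so joining [y ~ j] with [lower_cover j] would contract
    [j]. *)
Lemma uncontracted_min (j : L) : j \in JI L -> uncontracted j -> class_min j.
Proof.
move=> jJ nj y; rewrite le_eqVlt => /orP[/eqP//|yj] e.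
have [cj /(_ _ yj) yl] := JIP jJ; case/negP: nj.
have := congr_join (congr_refl T (lower_cover j)) e.
rewrite (join_idPl yl) => h.
by rewrite (join_idPr (ltW (covers_lt cj))) in h.
Qed.

Lemma uncontracted_proj (j : L) : j \in JI L -> uncontracted j ->
  qproj j \in JI Q /\ lower_cover (qproj j) = qproj (lower_cover j).
Proof.
move=> jJ nj; have [cj hj] := JIP jJ; have mj := uncontracted_min jJ nj.
have uniq a : covers a (qproj j) -> a = qproj (lower_cover j).
  case/(lower_covers_class_min mj) => y cy ->; congr qproj.
  have /coversP[yj hy] := cy.
  have := covers_lt cj.
  case: (hy (lower_cover j)) => [||->//|->]; rewrite ?ltxx ?hj //.
  by rewrite ltW // covers_lt.
have jQ : qproj j \in JI Q.
  apply: JI_unique_cover => [|a b /uniq -> /uniq ->//].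
  rewrite -qproj_bot qproj_eq; apply/negP => h.
  have e : \bot = j by apply: mj; rewrite ?le0x // congr_sym.
  by move: (covers_lt cj); rewrite -e ltx0.
by split=> //; apply: uniq; case: (JIP jQ).
Qed.

(** The least element [x] of the class is itself join-irreducible: two distinct lower covers would
    both project to the lower cover of [X], while their join [x] projects to [X]. *)
Lemma JI_quot (X : Q) : X \in JI Q ->
  exists j, [/\ j \in JI L, uncontracted j & X = qproj j].
Proof.
have [x [-> mx]] := class_min_exists X => xJ.
have [cX hX] := JIP xJ.
have xl : x \in JI L.
  apply: JI_unique_cover => [|a b ca cb].
    apply: contraTneq (covers_lt cX) => ->.
    by rewrite qproj_bot ltx0.
  have cover_proj y : covers y x -> qproj y = lower_cover (qproj x).
    move=> cy; have /coversP[yx hy] := qproj_covers cy (class_min_lower_cover mx cy).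
    case: (hy (lower_cover (qproj x))) => //; first exact: hX.
      by rewrite ltW // covers_lt.
    by move=> e; move: (covers_lt cX); rewrite {1}e ltxx.
  have /coversP[ax ha] := ca.
  case: (ha (a `|` b)); rewrite ?leUl // ?leUx ?(ltW ax) ?ltW ?covers_lt //.
    move=> e; have ba : b <= a by rewrite -e leUr.
    have /coversP[_ hb] := cb.
    by case: (hb a) => //; [exact: ltW | move=> eax; move: ax; rewrite eax ltxx].
  move=> e; have := class_min_lower_cover mx ca.
  rewrite -qproj_eq -[X in _ == qproj X]e qprojU (cover_proj a) // (cover_proj b) //.
  by rewrite joinxx eqxx.
exists x; split=> //; apply: class_min_lower_cover => //.
by case: (JIP xl).
Qed.

Hypothesis cg_inj : {in JI L &, injective (@cgJ d L)}.

Lemma cgJ_proj (j : L) : j \in JI L -> uncontracted j ->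
  cgJ (qproj j) = cg (qproj (lower_cover j)) (qproj j).
Proof. by move=> jJ nj; rewrite /cgJ (proj2 (uncontracted_proj jJ nj)). Qed.

Lemma cover_label_proj (j u v : L) : j \in JI L -> uncontracted j ->
  covers u v -> ~~ (u ~ v) ->
  cgJ (qproj j) = cg (qproj u) (qproj v) <-> cgJ j = cg u v.
Proof.
move=> jJ nj cuv nuv; rewrite cgJ_proj //; split; last exact: cg_proj_eq.
move=> e; apply: congr_le_anti; rewrite !cg_proj_le //.
by case: (JIP jJ).
Qed.

Lemma quot_cg_inj : {in JI Q &, injective (@cgJ d Q)}.
Proof.
move=> X Y /JI_quot[i [iJ ni ->]] /JI_quot[j [jJ nj ->]].
rewrite [cgJ (qproj j)]cgJ_proj // => /cover_label_proj e.
by rewrite (cg_inj iJ jJ) ?e //; case: (JIP jJ).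
Qed.

Lemma core_label_proj (x j : L) : class_min x -> j \in JI L -> uncontracted j ->
  (qproj j \in core_label_set (qproj x)) = (j \in core_label_set x).
Proof.
move=> mx jJ nj; apply/core_labelP/core_labelP => -[_ [u [v [h1 h2 h3 h4]]]].
- split=> //; move: h1 h2 h3 h4.
  have [u0 ->] := qproj_surj u; have [v0 ->] := qproj_surj v.
  rewrite class_min_nucleus // => h1 h2 h3 h4.
  (* Representatives of [u] and [v] are moved into the interval from [nucleus x] to [x] without
     leaving their classes. *)
  set a := (u0 `|` nucleus x) `&` x; set b := (v0 `|` a) `&` x.
  have nx : nucleus x <= x.
    apply: nucleus_self_le; apply: contraTneq (lt_le_trans (covers_lt h2) h3) => ->.
    by rewrite qproj_bot ltx0.
  have uv0 := ltW (covers_lt h2).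
  have ea : qproj a = qproj u0.
    by rewrite qprojI qprojU (join_idPl h1); apply/meet_idPl/(le_trans uv0).
  have eb : qproj b = qproj v0.
    by rewrite qprojI qprojU ea (join_idPl uv0); apply/meet_idPl.
  have ab : a <= b by rewrite lexI leUr leIr.
  rewrite -ea -eb in h2 h4.
  have [u1 [v1 [c1 au vb eu ev]]] := lift_covers ab h2.
  exists u1, v1; split=> //.
  + by apply: le_trans au; rewrite lexI leUr nx.
  + by apply: le_trans vb _; rewrite leIr.
  + apply/cover_label_proj => //.
      rewrite -qproj_eq (proj2 (qproj_eqP _ _) eu) (proj2 (qproj_eqP _ _) ev).
      by rewrite lt_eqF // covers_lt.
    by rewrite h4 (proj2 (qproj_eqP _ _) eu) (proj2 (qproj_eqP _ _) ev).
- have [jQ _] := uncontracted_proj jJ nj; split=> //.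
  have nuv : ~~ (u ~ v).
    by apply: contra nj; rewrite -!cg_le -h4.
  exists (qproj u), (qproj v); split.
  + by rewrite class_min_nucleus // qproj_homo.
  + exact: qproj_covers.
  + exact: qproj_homo.
  + exact/cover_label_proj.
Qed.

(** A coatom of [L] maps either to the top or to a coatom of [Q]. *)
Lemma quot_nucleus_top : nucleus (\top : L) = \bot -> nucleus (\top : Q) = \bot.
Proof.
move=> n0; apply: le_anti; rewrite le0x andbT -qproj_bot -n0.
rewrite (big_morph qproj qprojI qproj_top); apply: meets_ge => c cc.
have [h|h] := boolP (c ~ \top).
  by rewrite (proj2 (qproj_eqP _ _) h) lex1.
exact/nucleus_le/(qproj_covers cc h).
Qed.

(* A class meets [z_down, z] in a least element m; the uncontracted labels of
   [z_down, z] survive in [m_down `|` z_down, m], because m_down `|` z_down is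
   congruent to z_down. *)
Lemma core_label_descent (z : L) : ~ class_min z ->
  exists m, m < z /\ forall j, uncontracted j ->
    j \in core_label_set z -> j \in core_label_set m.
Proof.
move=> nz.
have [z0 cz0 ez0] : exists2 y, covers y z & y ~ z.
  have [/existsP[y /andP[]]|h] := boolP [exists y, covers y z && (y ~ z)].
    by exists y.
  case: nz => y; rewrite le_eqVlt => /orP[/eqP//|yz] e.
  have [w [cw yw]] := exists_lower_cover yz; case/existsP: h; exists w.
  rewrite cw /=; have := congr_join e (congr_refl T w).
  by rewrite (join_r yw) (join_l (ltW (covers_lt cw))).
have [|m [/and3P[zm mz em] hm]] :=
  @exists_minimal _ L [pred y | [&& nucleus z <= y, y <= z & y ~ z]] z0.
  by rewrite /= nucleus_le // ltW ?covers_lt.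
have z_bot : z != \bot by rewrite -lt0x (le_lt_trans (le0x z0)) // covers_lt.
have mmin y : nucleus z <= y -> y < m -> ~~ (y ~ m).
  move=> zy ym; apply/negP => e; have := ym.
  rewrite (hm y) ?ltxx //=; last exact: ltW.
  by rewrite zy (le_trans (ltW ym) mz) (congr_trans e em).
have mz' : m < z.
  rewrite lt_neqAle mz andbT; apply/eqP => e.
  have := mmin z0 (nucleus_le cz0); rewrite e covers_lt // ez0.
  by move=> /(_ isT).
exists m; split=> // j nj /core_labelP[jJ [u [v [zu cuv vz ej]]]].
have nuv : ~~ (u ~ v) by apply: contra nj; rewrite -!cg_le -ej.
(* The nucleus of the bottom is the top, so this case is excluded first: it would put everything
   below [z] in one class and contract the cover of [u] by [v]. *)
have m_bot : m != \bot.
  apply: contraNneq nuv => m0; rewrite m0 in zm em.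
  have hu w : w <= z -> \bot ~ w.
    move=> wz; have := congr_meet em (congr_refl T w).
    by rewrite meet0x (meet_r wz).
  have uz := le_trans (ltW (covers_lt cuv)) vz.
  by apply: congr_trans (hu _ vz); rewrite congr_sym hu.
set p := nucleus m `|` nucleus z.
have pm : p <= m by rewrite leUx nucleus_self_le.
have pz : p ~ nucleus z.
  have -> : nucleus z = p `&` nucleus z by rewrite meet_r // leUr.
  rewrite /(nucleus z); elim/big_rec: _ => [|y w cy IH].
    by rewrite meetx1 congr_refl.
  (* If [y] is not congruent to [z], a lower cover [y'] of [m] above the meet of [m] and [y] lies
     below [y], as otherwise [y'] would be congruent to [m]. Then [p] itself lies below [y]. *)
  suff py : p ~ p `&` y.
    have := congr_meet py IH.
    by rewrite meetxx meetACA meetxx.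
  have [yz|yz] := boolP (y ~ z).
    have := congr_meet (congr_refl T p) yz.
    by rewrite (meet_l (le_trans pm mz)) congr_sym.
  have zy := nucleus_le cy.
  have /coversP[y_lt hy] := cy.
  have [|y' [cy' my']] := @exists_lower_cover _ L (m `&` y) m.
    rewrite lt_neqAle leIl andbT; apply: contraNneq yz => e.
    have my : m <= y by rewrite -e leIr.
    have := congr_join em (congr_refl T y).
    by rewrite (join_r my) (join_l (ltW y_lt)).
  have zy' : nucleus z <= y' by apply: le_trans my'; rewrite lexI zm.
  have ny' := mmin y' zy' (covers_lt cy').
  have : y' <= y.
    case: (hy (y `|` y')) => [||e|e]; rewrite ?leUl //.
    - by rewrite leUx (ltW y_lt) (le_trans (ltW (covers_lt cy')) mz).
    - by rewrite -e leUr.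
    case/negP: ny'; apply: congr_trans (y `|` y') _ _ _ _.
      have := congr_join (congr_meet em (congr_refl T y)) (congr_refl T y').
      by rewrite (join_r my') (meet_r (ltW y_lt)).
    by rewrite e congr_sym.
  move=> y'y; rewrite meet_l ?congr_refl // (le_trans _ y'y) //.
  by rewrite leUx nucleus_le.
set a := p `|` (m `&` u); set b := p `|` (m `&` v).
have uv := ltW (covers_lt cuv).
have lift w : nucleus z <= w -> w <= z -> p `|` (m `&` w) ~ w.
  move=> zw wz; have := congr_join pz (congr_meet em (congr_refl T w)).
  by rewrite (meet_r wz) (join_r zw).
have ea : a ~ u by apply: lift => //; apply: le_trans vz.
have eb : b ~ v by apply: lift => //; apply: le_trans uv.
have ab : a <= b by rewrite leU2 // leI2.
have cab : covers (qproj a) (qproj b).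
  by rewrite (proj2 (qproj_eqP _ _) ea) (proj2 (qproj_eqP _ _) eb) qproj_covers.
have [u1 [v1 [c1 au vb eu ev]]] := lift_covers ab cab.
apply/core_labelP; split=> //; exists u1, v1; split=> //.
- by rewrite (le_trans _ au) // /a /p -joinA leUl.
- by rewrite (le_trans vb) // leUx pm leIl.
have pu : qproj u1 = qproj u by apply/qproj_eqP/(congr_trans eu).
have pv : qproj v1 = qproj v by apply/qproj_eqP/(congr_trans ev).
apply/cover_label_proj => //; first by rewrite -qproj_eq pu pv qproj_eq.
by rewrite pu pv; apply/cover_label_proj.
Qed.

Lemma quot_intersection_property :
  intersection_property L -> intersection_property Q.
Proof.
move=> ip X Y.
have [x [-> mx]] := class_min_exists X; have [y [-> my]] := class_min_exists Y.
pose U := [set j | uncontracted j].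
pose P := [pred z | core_label_set z :&: U ==
                    core_label_set x :&: core_label_set y :&: U].
have [z0 ez0] := ip x y.
have [|z [/eqP Pz minz]] := @exists_minimal _ L P z0; first by rewrite /= ez0.
have mz : class_min z.
  apply: boolp.contrapT => /core_label_descent[m [mz hm]].
  have [t et] := ip z m.
  have tm : t <= m by apply: core_label_subset_le => //; rewrite -et subsetIr.
  have : P t.
    rewrite /P /= -et -Pz; apply/eqP/setP => j; rewrite !in_setI.
    case: (boolP (j \in U)); rewrite ?andbF // => jU.
    case: (boolP (j \in core_label_set z)) => //= jz.
    by rewrite hm //; rewrite inE in jU.
  move/minz => /(_ (le_trans tm (ltW mz))) e.
  by move: mz; rewrite lt_leAnge -{2}e tm andbF.
exists (qproj z); apply/setP => J; rewrite in_setI.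
have [/JI_quot[j [jJ nj ->]]|nJ] := boolP (J \in JI Q); last first.
  have notin w : (J \in core_label_set w) = false.
    by apply: contraNF nJ => /core_labelP[].
  by rewrite !notin.
rewrite !core_label_proj //; move/setP/(_ j): Pz.
have jU : j \in U by rewrite inE.
by rewrite !in_setI jU !andbT => ->.
Qed.

End QuotientLabels.

(** * Kuhn's cubical lemma *)

Section Kuhn.
Variables (n k : nat).
Local Notation point := {ffun 'I_n -> 'I_k.+1}.
Local Notation "\xor_ ( i 'in' A ) F" := (\big[addb/false]_(i in A) F)
  (at level 36, F at level 36, i, A at level 50).
Local Notation "\xor_ ( i | P ) F" := (\big[addb/false]_(i | P) F)
  (at level 36, F at level 36, i, P at level 50).
Local Notation "\xor_ i F" := (\big[addb/false]_i F)
  (at level 36, F at level 36, i at level 0).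
Implicit Types (q : point) (A S : {set 'I_n}) (i j : 'I_n).

(* Coordinates are incremented cyclically, but no wrap-around is ever met on
   the cubes inside the grid. *)
Definition grid_move q A : point :=
  [ffun i => if i \in A then ordS (q i) else q i].

Definition grid_shift q j : point := grid_move q [set j].

Definition grid_unshift q j : point :=
  [ffun i => if i == j then ord_pred (q i) else q i].

Lemma grid_unshiftK j : cancel (grid_unshift^~ j) (grid_shift^~ j).
Proof.
move=> q; apply/ffunP => i; rewrite !ffunE in_set1.
by case: eqP => // _; rewrite ord_predK.
Qed.

Lemma grid_move_shift q A j : j \notin A ->
  grid_move (grid_shift q j) A = grid_move q (j |: A).
Proof.
move=> jA; apply/ffunP => i; rewrite !ffunE in_set1 in_setU1.
by case: eqP => [->|//]; rewrite (negbTE jA).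
Qed.

Lemma grid_shiftC q i j :
  grid_shift (grid_shift q i) j = grid_shift (grid_shift q j) i.
Proof.
by apply/ffunP => m; rewrite !ffunE !in_set1; do 2!case: eqP.
Qed.

(* The coboundary mod 2 of a cochain on the cubes (q, S), where (q, S) has
   base point q and edge directions S. *)
Definition coboundary (c : point -> {set 'I_n} -> bool) q S : bool :=
  \xor_(j in S) (c (grid_shift q j) (S :\ j) (+) c q (S :\ j)).

(** The terms at [(i, j)] and [(j, i)] cancel mod 2; this makes the coboundary square to zero. *)
Lemma xor_symmetric (g : 'I_n -> 'I_n -> bool) S :
  (forall i j, g i j = g j i) ->
  \xor_(j in S) \xor_(i in S :\ j) g i j = false.
Proof.
move=> gC.
have e j : \xor_(i in S :\ j) g i j =
  (\xor_(i | (i \in S) && (i < j)%N) g i j) (+)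
  (\xor_(i | (i \in S) && (j < i)%N) g i j).
  rewrite (bigID (fun i : 'I_n => (i < j)%N)) /=; congr (_ (+) _); apply: eq_bigl => i;
    rewrite !inE -(inj_eq val_inj) /= andbC; case: ltngtP => //=; rewrite ?andbT ?andbF //.
under eq_bigr do rewrite e.
rewrite big_split /= [X in X (+) _](exchange_big_dep (mem S)) /=; last first.
  by move=> i j _ /andP[].
rewrite -big_split big1 //= => j jS.
rewrite [X in _ (+) X](eq_big (fun i => (i \in S) && ((j \in S) && (j < i)%N))
  (fun i => g j i)) ?addbb // => i.
by rewrite jS.
Qed.

Lemma coboundary_coboundary c q S : coboundary (coboundary c) q S = false.
Proof.
rewrite /coboundary; under eq_bigr do rewrite -big_split /=.
rewrite (@xor_symmetric (fun i j =>
  (c (grid_shift (grid_shift q j) i) (S :\ j :\ i) (+)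
     c (grid_shift q j) (S :\ j :\ i)) (+)
  (c (grid_shift q i) (S :\ j :\ i) (+) c q (S :\ j :\ i)))) // => i j.
rewrite grid_shiftC (_ : S :\ j :\ i = S :\ i :\ j); last first.
  by apply/setP => m; rewrite !inE andbCA.
rewrite -!addbA; congr (_ (+) _); exact: addbCA.
Qed.

Variable l : 'I_n -> point -> bool.

(* The cup product of the coboundaries of the labels l i for i in s: as
   label_cup s' is closed, d (l i . label_cup s') = d (l i) . label_cup s'. *)
Fixpoint label_cup (s : seq 'I_n) : point -> {set 'I_n} -> bool :=
  if s is i :: s' then coboundary (fun q S => l i q && label_cup s' q S)
  else fun _ S => S == set0.

Lemma label_cup_closed s q S : coboundary (label_cup s) q S = false.
Proof.
case: s => [|i s]; last exact: coboundary_coboundary.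
by rewrite /coboundary big1 // => j _; rewrite addbb.
Qed.

(** The Leibniz rule: adding the vanishing term with the coboundary of [label_cup s] leaves only
    differences of the label [i]. *)
Lemma label_cupE i s q S : label_cup (i :: s) q S =
  \xor_(j in S) ((l i (grid_shift q j) (+) l i q) &&
                 label_cup s (grid_shift q j) (S :\ j)).
Proof.
transitivity (label_cup (i :: s) q S (+) (l i q && coboundary (label_cup s) q S)).
  by rewrite label_cup_closed andbF addbF.
rewrite /= /coboundary big_distrr -big_split /=.
apply: eq_bigr => j _; case: (l i q); case: (l i _) => //=;
  by case: (label_cup s _ _) => //=; case: (label_cup s _ _).
Qed.

Lemma label_cup_const i s q S : i \in s ->
  (forall A, A \subset S -> l i (grid_move q A) = l i q) ->
  label_cup s q S = false.
Proof.
elim: s q S => // i' s IH q S; rewrite inE => i_s h.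
rewrite label_cupE big1 // => j jS; case/orP: i_s => [/eqP <-|/IH IHs].
  by rewrite h ?sub1set // addbb.
rewrite IHs ?andbF // => A AS.
have jA : j \notin A by apply: contraTN AS => jA; apply/subsetP => /(_ _ jA); rewrite !inE eqxx.
rewrite grid_move_shift // !h ?sub1set // subUset sub1set jS.
by apply: subset_trans AS (subsetDl _ _).
Qed.

Hypothesis k_gt0 : (0 < k)%N.
Hypothesis l_low : forall i q, q i = 0%N :> nat -> l i q = false.
Hypothesis l_high : forall i q, q i = k :> nat -> l i q = true.

(** Base points of the unit cubes in the face of the grid where every coordinate outside [S] is
    maximal. *)
Definition in_box S q : bool :=
  [forall i, if i \in S then (q i < k)%N else q i == k :> nat].

Lemma ord_pred_lt (x : 'I_k.+1) : (ord_pred x < k)%N = (0 < x)%N.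
Proof.
case: x => [[|x] xk] /=; first by rewrite modn_small ?ltnn.
by rewrite modnDr modn_small // ltnW.
Qed.

(** Induction on the dimension by Stokes' theorem. On the two facets orthogonal to a direction [j]
    in [s] the label [j] is constant, so they contribute nothing. In direction [i] the label is
    false on the lower facet and true on the upper one, which is the box for [s]. *)
Lemma label_cup_box s : uniq s ->
  \xor_q (in_box [set i in s] q && label_cup s q [set i in s]) = true.
Proof.
elim: s => [_|i s IH /= /andP[is_ us]].
  rewrite (bigD1 [ffun=> ord_max]) //= big1 => [|q qm].
    rewrite addbF; apply/andP; split; last by apply/eqP/setP => i; rewrite !inE.
    by apply/forallP => i; rewrite inE /= ffunE.
  apply: contraNF qm => /andP[/forallP h _]; apply/eqP/ffunP => i.
  by apply: val_inj; rewrite ffunE; have := h i; rewrite inE => /eqP.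
set S := [set i0 in i :: s]; set c := fun q S => l i q && label_cup s q S.
have Si : S :\ i = [set i in s].
  by apply/setP => j; rewrite !inE; case: eqP => // ->; rewrite (negbTE is_).
under eq_bigr do rewrite big_distrr /=.
rewrite exchange_big /=.
(* Summation by parts: translating the box instead of the cochain leaves the indicator of the facets
   where [q j] is [0] or [k]. *)
have flux j : \xor_q (in_box S q && (c (grid_shift q j) (S :\ j) (+) c q (S :\ j)))
   = \xor_q ((in_box S (grid_unshift q j) (+) in_box S q) && c q (S :\ j)).
  under eq_bigr do rewrite andb_addr; under [RHS]eq_bigr do rewrite andb_addl.
  rewrite !big_split /=; congr (_ (+) _).
  rewrite (reindex_inj (can_inj (grid_unshiftK j))) /=.
  by under eq_bigr do rewrite grid_unshiftK.
under eq_bigr do rewrite flux.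
pose rest j q := [forall (m | m != j), if m \in S then (q m < k)%N else q m == k :> nat].
have boxE j q : j \in S -> in_box S q = rest j q && (q j < k)%N.
  move=> jS; apply/forallP/andP => [h|[/forallP h qj] m].
    by split; [apply/forallP => m; apply/implyP | have := h j; rewrite jS].
  by have := h m; case: eqP => [->|//]; rewrite jS.
have boxU j q : j \in S -> in_box S (grid_unshift q j) = rest j q && (0 < q j)%N.
  move=> jS; rewrite (boxE j) // ffunE eqxx ord_pred_lt; congr (_ && _).
  by apply: eq_forallb => m; case: (boolP (m == j)) => //= mj; rewrite ffunE (negbTE mj).
rewrite (bigD1 i) /=; last by rewrite !inE eqxx.
rewrite [X in _ (+) X]big1 ?addbF => [|j /andP[jS ji]].
  rewrite -[RHS]IH //; apply: eq_bigr => q _; rewrite (boxU i) ?(boxE i) ?inE ?eqxx // Si /c.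
  have -> : in_box [set i in s] q = rest i q && (q i == k :> nat).
    apply/forallP/andP => [h|[/forallP h qi] m].
      split; last by have := h i; rewrite inE (negbTE is_).
      by apply/forallP => m; apply/implyP => mi; have := h m; rewrite !inE (negbTE mi).
    have := h m; rewrite !inE; case: eqP => //= ->.
    by rewrite (negbTE is_).
  case: (rest i q) => //=; have := ltn_ord (q i); rewrite ltnS leq_eqVlt => /orP[/eqP e|lt].
    by rewrite l_high // e k_gt0 ltnn eqxx.
  rewrite lt (ltn_eqF lt) /=; case: posnP => [e|//].
  by rewrite l_low.
have js : j \in s by move: jS; rewrite !inE (negbTE ji).
rewrite big1 // => q _; rewrite (boxU j) // (boxE j) //.
suff : (q j = 0%N :> nat) \/ (q j = k :> nat) -> label_cup s q (S :\ j) = false.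
  rewrite /c; case: (rest j q) => //= h; case: posnP => [e|q0].
    by rewrite h ?andbF; auto.
  have := ltn_ord (q j); rewrite ltnS leq_eqVlt => /orP[/eqP e|-> //].
  by rewrite h ?andbF; auto.
move=> qj; apply: (label_cup_const js) => A AS.
have e : grid_move q A j = q j.
  by rewrite ffunE; case: ifP => // /(subsetP AS); rewrite !inE eqxx.
by case: qj => qj; [rewrite !l_low ?e | rewrite !l_high ?e].
Qed.

Lemma kuhn : exists q, (forall i, (q i < k)%N) /\
  forall i, exists A, l i (grid_move q A) != l i q.
Proof.
have : \xor_q (in_box [set i in enum 'I_n] q &&
   label_cup (enum 'I_n) q [set i in enum 'I_n]) = true.
  by apply: label_cup_box; rewrite enum_uniq.
set S := [set i in enum 'I_n] => h.
have [q /andP[/forallP bq wq]] : exists q, in_box S q && label_cup (enum 'I_n) q S.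
  apply/existsP; apply: contraPT h => /existsPn h.
  by rewrite big1 // => q _; apply/negbTE.
exists q; split=> i; first by have := bq i; rewrite inE mem_enum.
apply/existsP; apply: contraTT wq => /existsPn hA.
rewrite (@label_cup_const i) // ?mem_enum // => A _.
by apply/eqP; rewrite -[_ == _]negbK.
Qed.

End Kuhn.

From mathcomp Require Import boolp classical_sets functions topology normedtype.
From mathcomp Require Import sequences realfun.
Import GRing.Theory Num.Theory numFieldNormedType.Exports.

(** * Non-contractibility of spheres *)

Section PoincareMiranda.
Local Open Scope classical_set_scope.
Local Open Scope ring_scope.

Definition in_cube (R : realType) n (x : 'rV[R]_n) := forall i, -1 <= x ord0 i <= 1.

Variables (R : realType) (n : nat) (F : 'rV[R]_n -> 'rV[R]_n).
Hypothesis F_cont : continuous F.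
Hypothesis F_low : forall x i, in_cube x -> x ord0 i = -1 -> F x ord0 i < 0.
Hypothesis F_high : forall x i, in_cube x -> x ord0 i = 1 -> 0 < F x ord0 i.

(** Kuhn's lemma on the grid of mesh [2 / k.+1], each point labelled by the positivity of the
    coordinates of [F]. *)
Lemma small_sign_change (k : nat) : exists x : 'rV[R]_n, in_cube x /\
  forall i, exists y : 'rV[R]_n, (forall j, `|x ord0 j - y ord0 j| <= 2 / k.+1%:R) /\
                      (0 < F y ord0 i) != (0 < F x ord0 i).
Proof.
pose pt (q : {ffun 'I_n -> 'I_k.+2}) : 'rV[R]_n :=
  \row_i (2 * (q i : nat)%:R / k.+1%:R - 1).
have k0 : 0 < k.+1%:R :> R by rewrite ltr0n.
have pt_cube q : in_cube (pt q).
  move=> i; rewrite mxE lerBrDr addrC subrr lerBlDr.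
  rewrite divr_ge0 ?mulr_ge0 ?ler0n //= ler_pdivrMr // ler_wpM2l ?ler0n //.
  by rewrite ler_nat -ltnS.
have [|i q qi|i q qi|q [qk hq]] := @kuhn n k.+1 (fun i q => 0 < F (pt q) ord0 i).
- by [].
- apply/negbTE; rewrite -leNgt; apply/ltW/F_low; first exact: pt_cube.
  by rewrite mxE qi mulr0 mul0r sub0r.
- apply: F_high; first exact: pt_cube.
  by rewrite mxE qi mulfK ?gt_eqF // -[1]/(1%:R) -natrB.
exists (pt q); split=> // i.
have [A hA] := hq i; exists (pt (grid_move q A)); split=> // j.
rewrite !mxE opprB addrA subrK -mulrBl -mulrBr normrM normrM normfV (gtr0_norm k0) normr_nat.
rewrite ler_pM2r ?invr_gt0 // ler_piMr // ffunE; case: ifP => _.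
  (* As [q j < k.+1], the cyclic successor does not wrap around. *)
  have qj : ((q j).+1 < k.+2)%N by rewrite ltnS.
  by rewrite /= modn_small // -natr1 opprD addrA subrr add0r normrN normr1.
by rewrite subrr normr0.
Qed.

(** At a cluster point [x] of the [x_ k], a nonzero coordinate of [F x] would keep its sign near
    [x], against the sign changes at ever smaller distances. *)
Lemma poincare_miranda : exists x, F x = 0.
Proof.
have /choice[x_ x_P] := small_sign_change.
have cube_compact : compact [set x : 'rV[R]_n | forall i, `[-1, 1]%classic (x ord0 i)].
  by apply: (@rV_compact R n (fun=> `[-1, 1]%classic)) => i; exact: segment_compact.
have [|x [_ clx]] := cube_compact (x_ @ \oo).
  exists 0%N => // N _ i /=; rewrite in_itv /=; exact: (x_P N).1.
exists x; apply/rowP => i; rewrite mxE; apply/eqP; apply: contraT => Fxi.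
pose b := 0 < F x ord0 i.
have /nbhs_ballP[e /= e0 he] : \forall y \near x, (0 < F y ord0 i) = b.
  have cF : (fun y => F y ord0 i) @ x --> F x ord0 i.
    exact: (continuous_comp (@F_cont x) (@coord_continuous R 1 n ord0 i (F x))).
  rewrite /b; case: ltgtP Fxi => // hF _; last first.
    near=> y; apply/negbTE; rewrite -leNgt; apply: ltW; near: y.
    exact: (cvgr_lt _ cF).
  near=> y; apply/idP; near: y; exact: (cvgr_gt _ cF).
(* Half of the radius is for the distance from [x] to [x_ N], half for that from [x_ N] to the point
   with the other sign. *)
have e2 : 0 < e / 2 by rewrite divr_gt0.
have [] := clx [set y | exists2 N, 2 / N.+1%:R < e / 2 & y = x_ N] (ball x (e / 2)).
- suff : \forall N \near \oo, 2 / N.+1%:R < e / 2.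
    by apply: filterS => N hN; exists N.
  near=> N; rewrite ltr_pdivrMr ?ltr0n // -ltr_pdivrMl //; rewrite -[N.+1%:R]natr1 ltr_wpDr //; near: N.
  exact: nbhs_infty_gtr.
- exact: nbhsx_ballx.
move=> _ [[N hN ->] hx].
have [y [yx /negP[]]] := (x_P N).2 i; apply/eqP; rewrite !he //.
  by apply: le_ball hx; rewrite ler_pdivrMr // mulrDr mulr1 lerDl ltW.
rewrite (splitr e); apply: ball_triangle hx _; split=> // i' j.
by rewrite /ball /= ord1 (le_lt_trans (yx j)).
Unshelve. all: by end_near. Qed.

End PoincareMiranda.

(** * Extending homotopies in time and transporting contractions *)

Section Contractions.
Local Open Scope classical_set_scope.
Local Open Scope ring_scope.

Lemma set_type_continuous_at (X Y : topologicalType) (A : set X)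
    (f : Y -> set_type A) (y : Y) :
  {for y, continuous (fun t => set_val (f t))} -> {for y, continuous f}.
Proof.
move=> cf U [_ /= [[W oW <-]] /= Wa WU].
have hW : nbhs y ((fun t => set_val (f t)) @^-1` W).
  by apply: cf; apply: open_nbhs_nbhs.
by apply: filterS hW => t Wt; apply: WU.
Qed.

Lemma set_val_continuous (X : topologicalType) (A : set X) :
  continuous (set_val : set_type A -> X).
Proof. exact: initial_continuous. Qed.

Lemma fst_continuous_at (X Y : topologicalType) (z : X * Y) :
  {for z, continuous (@fst X Y)}.
Proof. by case: z => x y; exact: cvg_fst. Qed.

Lemma snd_continuous_at (X Y : topologicalType) (z : X * Y) :
  {for z, continuous (@snd X Y)}.
Proof. by case: z => x y; exact: cvg_snd. Qed.

Lemma pair_continuous_at (X Y Z : topologicalType) (f : X -> Y) (g : X -> Z)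
    (x : X) : {for x, continuous f} -> {for x, continuous g} ->
  {for x, continuous (fun t => (f t, g t))}.
Proof. by move=> cf cg; exact: cvg_pair. Qed.

(* Homotopies are only continuous within [0, 1]; a contraction is a homotopy
   from a constant map to the identity, extended to all times by constants. *)
Definition contracting_homotopy (R : realType) (X : topologicalType) (p : X)
    (G : X * R -> X) :=
  [/\ continuous G, forall x t, t <= 0 -> G (x, t) = p &
      forall x t, 1 <= t -> G (x, t) = x].

(** Clamping time to [[0, 1]] turns continuity within the slab into continuity everywhere. *)
Lemma extend_homotopy (R : realType) (X Y : topologicalType) (f g : X -> Y) :
  homotopic R f g -> exists G : X * R -> Y,
    [/\ continuous G, forall x t, t <= 0 -> G (x, t) = f x &
        forall x t, 1 <= t -> G (x, t) = g x].
Proof.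
move=> [H [cH H0 H1]]; pose cl (t : R) : R := Num.max 0 (Num.min t 1).
have cl01 t : 0 <= cl t <= 1 by rewrite le_max lexx /= ge_max ler01 ge_min lexx orbT.
have ccl : continuous cl.
  move=> t; apply: (@continuous_max R R (fun=> 0) (id \min (fun=> 1)) t).
    exact: cvg_cst.
  by apply: continuous_min; [exact: cvg_id|exact: cvg_cst].
exists (fun z => H (z.1, cl z.2)); split=> [[x t]|x t t0|x t t1] /=.
- move=> U; rewrite /= => HU.
  have zin : ([set: X] `*` `[0, 1]) (x, cl t).
    by split=> //=; rewrite in_itv /=; exact: cl01.
  have := cH (x, cl t) U HU.
  rewrite /nbhs /= -nbhs_subspace_in // => hw.
  have cz : {for (x, t), continuous (fun z : X * R => (z.1, cl z.2))}.
    apply: pair_continuous_at; first exact: fst_continuous_at.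
    exact: (continuous_comp (@snd_continuous_at _ _ _) (@ccl _)).
  apply: (@filterS _ (nbhs (x, t)) _ _ _ _ (cz _ hw)) => -[y s] /=.
  apply; split=> //=.
  by rewrite in_itv /=; exact: cl01.
- by rewrite /cl max_l // ge_min t0.
- by rewrite /cl min_r // max_r.
Qed.

Lemma paste_continuous (R : realType) (X Y : topologicalType)
    (A B : X * R -> Y) (c : R) :
  continuous A -> continuous B -> (forall x, A (x, c) = B (x, c)) ->
  continuous (fun z => if z.2 <= c then A z else B z).
Proof.
move=> cA cB AB [x t] U /=.
have csnd := @snd_continuous_at X R (x, t).
have nearP (P Q : set (X * R)) : nbhs (x, t) P -> nbhs (x, t) Q ->
    P `&` Q `<=` (fun z => if z.2 <= c then A z else B z) @^-1` U ->
    nbhs (x, t) ((fun z => if z.2 <= c then A z else B z) @^-1` U).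
  by move=> hP hQ PQ; apply: filterS PQ _; exact: filterI.
case: (ltgtP t c) => [tc|ct|tc] hU.
- apply: (nearP (A @^-1` U) [set z | z.2 < c]); [exact: cA|exact: (cvgr_lt _ csnd)|].
  move=> z [/= Uz zc].
  by rewrite /= (ltW zc).
- apply: (nearP (B @^-1` U) [set z | c < z.2]); [exact: cB|exact: (cvgr_gt _ csnd)|].
  move=> z [/= Uz zc].
  by rewrite /= leNgt zc.
- have hB : nbhs (B (x, t)) U by rewrite tc -AB -tc.
  apply: (nearP (A @^-1` U) (B @^-1` U)); [exact: cA|exact: cB|].
  move=> z [/= UA UB].
  by rewrite /=; case: ifP.
Qed.

(** Up to time one half run [K] between [g] and [f], from the constant [f p] to [f \o g]; afterwards
    run the homotopy from [f \o g] to the identity. *)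
Lemma homotopy_equivalent_contraction (R : realType) (X Y : topologicalType)
    (p : X) (K : X * R -> X) :
  homotopy_equivalent R X Y -> contracting_homotopy p K ->
  exists q (G : Y * R -> Y), contracting_homotopy q G.
Proof.
move=> [f [g [cf cg _ /extend_homotopy[H [cH H0 H1]]]]] [cK K0 K1].
pose A (z : Y * R) := f (K (g z.1, 2 * z.2)).
pose B (z : Y * R) := H (z.1, 2 * z.2 - 1).
exists (f p), (fun z => if z.2 <= 2^-1 then A z else B z); split.
- apply: paste_continuous.
  + move=> z; apply: continuous_comp (@cf _); apply: continuous_comp (@cK _).
    apply: pair_continuous_at.
      exact: (continuous_comp (@fst_continuous_at _ _ _) (@cg _)).
    by apply: cvgM; [exact: cvg_cst|exact: snd_continuous_at].
  + move=> z; apply: continuous_comp (@cH _).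
    apply: pair_continuous_at; first exact: fst_continuous_at.
    apply: cvgB; last exact: cvg_cst.
    by apply: cvgM; [exact: cvg_cst|exact: snd_continuous_at].
  + by move=> y; rewrite /A /B /= mulfV ?pnatr_eq0 // K1 // H0 // subrr.
- move=> y t t0 /=; rewrite ifT; last by rewrite (le_trans t0) // invr_ge0.
  by rewrite /A K0 //= pmulr_rle0.
- move=> y t t1 /=; rewrite ifF; last first.
    by apply/negbTE; rewrite -ltNge (lt_le_trans _ t1) // invf_lt1 // ltr1n.
  by rewrite /B H1 //= lerBrDr -[1 + 1]/(2%:R) ler_peMr.
Qed.

End Contractions.

(** * The Euclidean unit sphere *)

Section Sphere.
Local Open Scope classical_set_scope.
Local Open Scope ring_scope.
Variables (R : realType) (n : nat).
Local Notation S := (set_type (unit_sphere R n)).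

Definition euclid (x : 'rV[R]_n) : R := Num.sqrt (\sum_(i < n) x ord0 i ^+ 2).

Lemma euclid_continuous : continuous euclid.
Proof.
move=> x; apply: continuous_comp (@sqrt_continuous R _).
have cs : continuous (fun y : 'rV[R]_n => \sum_(i < n) y ord0 i ^+ 2).
  apply: continuous_big => [|i _ y]; first exact: add_continuous.
  exact: (continuous_comp (@coord_continuous _ _ _ _ _ _) (@exprn_continuous _ _ _)).
exact: cs.
Qed.

Lemma sumsq_ge0 (x : 'rV[R]_n) : 0 <= \sum_(i < n) x ord0 i ^+ 2.
Proof. by apply: sumr_ge0 => i _; exact: sqr_ge0. Qed.

Lemma euclid_coord (x : 'rV[R]_n) i : `|x ord0 i| <= euclid x.
Proof.
rewrite -sqrtr_sqr ler_sqrt ?sumsq_ge0 // (bigD1 i) //= lerDl.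
by apply: sumr_ge0 => j _; exact: sqr_ge0.
Qed.

Variables (p : S) (G : S * R -> S).

Definition sphere_proj (x : 'rV[R]_n) : S := insubd p ((euclid x)^-1 *: x).

Lemma sphere_projE (x : 'rV[R]_n) : euclid x != 0 ->
  set_val (sphere_proj x) = (euclid x)^-1 *: x.
Proof.
move=> x0; rewrite set_valE /= val_insubd ifT //; apply/mem_set; rewrite /unit_sphere /=.
under eq_bigr do rewrite mxE exprMn.
rewrite -mulr_sumr -[X in _ * X]sqr_sqrtr ?sumsq_ge0 // -exprMn.
by rewrite mulVf // expr1n.
Qed.

Lemma sphere_proj_continuous (x : 'rV[R]_n) : euclid x != 0 ->
  {for x, continuous sphere_proj}.
Proof.
move=> x0.
have h : {for x, continuous (fun y => (euclid y)^-1 *: y)}.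
  apply: continuousZ; last exact: cvg_id.
  by apply: continuousV => //; exact: euclid_continuous.
have hn : nbhs x [set y | euclid y != 0].
  exact: (cvgr_neq0 _ (euclid_continuous (x := x)) x0).
apply: set_type_continuous_at => U /=; rewrite sphere_projE // => /h hU.
suff : nbhs x ((fun y => set_val (sphere_proj y)) @^-1` U) by [].
have {}hU : nbhs x ((fun y => (euclid y)^-1 *: y) @^-1` U) by exact: hU.
apply: (@filterS _ (nbhs x) _ _ _ _ (filterI hU hn)) => y [/= Uy y0].
by rewrite sphere_projE.
Qed.

(* A contraction of the sphere extends the radial retraction x/|x| of the
   exterior to the whole space, against Poincare-Miranda on the cube. *)
Lemma sphere_not_contractible : ~ contracting_homotopy p G.
Proof.
move=> [cG G0 G1].
(* For [euclid x] at most one half the time is nonpositive and [F] is constant, so the default value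
   of [sphere_proj] at the origin does no harm; once [euclid x] reaches [1], so does the time, and
   [F x] is [x] normalised. *)
pose F x := set_val (G (sphere_proj x, 2 * euclid x - 1)).
have cF : continuous F.
  move=> x; have [x0|x0] := eqVneq (euclid x) 0.
    have Fp y : euclid y < 2^-1 -> F y = set_val p.
      by move=> y2; rewrite /F G0 // subr_le0 -ler_pdivlMl // mulr1 ltW.
    have h : F @ x --> set_val p.
      apply: (@cvg_near_cst _ _ _ _ (nbhs x)).
      apply: (@filterS _ (nbhs x) _ _ _ Fp).
      by apply: (cvgr_lt _ (euclid_continuous (x := x))); rewrite x0 invr_gt0.
    by move=> U; rewrite (Fp x) ?x0 ?invr_gt0 //; exact: h.
  apply: continuous_comp (@set_val_continuous _ _ _).
  apply: continuous_comp (@cG _); apply: pair_continuous_at; first exact: sphere_proj_continuous.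
  have affine (t : R) : {for t, continuous (fun s : R => 2 * s - 1)}.
    by apply: cvgB; [apply: cvgM; [exact: cvg_cst|exact: cvg_id]|exact: cvg_cst].
  exact: (continuous_comp (@euclid_continuous x) (affine _)).
have F_out x : 1 <= euclid x -> F x = (euclid x)^-1 *: x.
  move=> x1; rewrite /F G1 ?sphere_projE // ?gt_eqF ?(lt_le_trans ltr01) //.
  by rewrite lerBrDr -[1 + 1]/(2%:R) ler_peMr.
have far (x : 'rV[R]_n) i : `|x ord0 i| = 1 -> 1 <= euclid x.
  by move=> <-; exact: euclid_coord.
have [x i _ xi|x i _ xi|x Fx] := @poincare_miranda R n F cF.
- have x1 : 1 <= euclid x by apply: (far x i); rewrite xi normrN normr1.
  by rewrite F_out // mxE xi mulrN1 oppr_lt0 invr_gt0 (lt_le_trans ltr01).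
- have x1 : 1 <= euclid x by apply: (far x i); rewrite xi normr1.
  by rewrite F_out // mxE xi mulr1 invr_gt0 (lt_le_trans ltr01).
have : unit_sphere R n (F x) by apply/set_mem; rewrite /F set_valE; exact: valP.
rewrite Fx /unit_sphere /= big1 => [/eqP|i _]; first by rewrite eq_sym oner_eq0.
by rewrite mxE expr0n.
Qed.

End Sphere.

(** * Contracting the order complex *)

Section OrderComplexContraction.
Local Open Scope classical_set_scope.
Local Open Scope ring_scope.

Lemma ptws_continuous_at (Y : topologicalType) (V : Type) (U : topologicalType)
    (f : Y -> {ptws V -> U}) (y : Y) :
  (forall v, {for y, continuous (fun t => f t v)}) -> {for y, continuous f}.
Proof.
move=> cf; apply/cvg_sup => i W [_ /= [[B oB <-]] /= By BW].
have hB : nbhs y ((fun t => f t i) @^-1` B).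
  by apply: cf; apply: open_nbhs_nbhs.
by apply: (@filterS _ (nbhs y) _ _ _ _ hB) => t Bt; apply: BW.
Qed.

Lemma ptws_eval_continuous (V : Type) (U : topologicalType) (v : V) :
  continuous (fun f : {ptws V -> U} => f v).
Proof.
move=> f W hW; have /cvg_sup/(_ v) h : f --> f by exact: cvg_id.
by apply: h; exact: (@initial_continuous _ _ (fun g : V -> U => g v) f W hW).
Qed.

Variables (R : realType) (d : Order.disp_t) (L : finTBLatticeType d).
Variables (A : {set L}) (b : L).
Hypothesis bA : b \in A.
Hypothesis joinA : forall v, v \in A -> (v `|` b)%O \in A.

Local Notation X := (set_type (geometric_realization R (order_complex A))).
Implicit Types (t : L -> R) (s m : R) (u v w : L).

(* The top m units of mass of t, counted from the top of its chain. *)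
Definition top_mass t m v : R :=
  Num.min (t v) (Num.max 0 (m - \sum_(w | (v < w)%O) t w)).

Definition push_top t m u : R :=
  t u - top_mass t m u + \sum_(v | (v `|` b)%O == u) top_mass t m v.

Definition cone_weight s : R := Num.max 0 (Num.min 1 (1 - 2 * s)).

(* For s from 1 down to 1/2 the mass is pushed from v to v `|` b, starting at
   the top of the chain so that the support stays a chain; then it moves
   linearly to the vertex b. *)
Definition cone_contract t s u : R :=
  (1 - cone_weight s) * push_top t (2 - 2 * s) u + cone_weight s * (u == b)%:R.

Lemma cone_weight01 s : 0 <= cone_weight s <= 1.
Proof. by rewrite le_max lexx /= ge_max ler01 ge_min lexx. Qed.

Section Mass.
Variable t : L -> R.
Hypothesis t_ge0 : forall v, 0 <= t v.
Hypothesis t_sum : \sum_v t v = 1.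

Lemma ler_sum_subpred (P Q : pred L) : subpred P Q ->
  \sum_(w | P w) t w <= \sum_(w | Q w) t w.
Proof.
move=> PQ; rewrite big_mkcond [leRHS]big_mkcond; apply: ler_sum => w _.
by case: ifP => [/PQ ->//|_]; case: ifP.
Qed.

Lemma top_mass_ge0 m v : 0 <= top_mass t m v.
Proof. by rewrite le_min t_ge0 le_max lexx. Qed.

Lemma top_mass_le m v : top_mass t m v <= t v.
Proof. by rewrite ge_min lexx. Qed.

Lemma top_mass0 m v : m <= 0 -> top_mass t m v = 0.
Proof.
move=> m0; rewrite /top_mass max_l ?min_r //.
by rewrite subr_le0 (le_trans m0) // sumr_ge0.
Qed.

Lemma top_mass_full m v : 1 <= m -> top_mass t m v = t v.
Proof.
move=> m1; rewrite /top_mass min_l // le_max; apply/orP; right.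
rewrite lerBrDr (le_trans _ m1) // -t_sum [leRHS](bigD1 v) //= lerD2l.
by apply: ler_sum_subpred => w; move/gt_eqF => ->.
Qed.

(** Mass is taken from the top down, so nothing at [v] moves before everything above [v] has
    moved. *)
Lemma top_mass_above m u v : (v < u)%O -> 0 < top_mass t m v ->
  top_mass t m u = t u.
Proof.
move=> vu; rewrite /top_mass lt_min lt_max ltxx /= subr_gt0 => /andP[_ hm].
rewrite min_l // le_max; apply/orP; right; rewrite lerBrDr; apply: ltW.
apply: le_lt_trans hm; rewrite [leRHS](bigD1 u) //= lerD2l.
apply: ler_sum_subpred => w uw; rewrite (lt_trans vu uw) /=.
by rewrite gt_eqF.
Qed.

Lemma push_top_ge0 m u : 0 <= push_top t m u.
Proof.
by rewrite addr_ge0 ?subr_ge0 ?top_mass_le // sumr_ge0 // => v _; exact: top_mass_ge0.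
Qed.

Lemma push_top_sum m : \sum_u push_top t m u = 1.
Proof.
rewrite big_split /= sumrB t_sum.
rewrite (exchange_big_dep xpredT) //=.
rewrite [X in _ + X](eq_bigr (top_mass t m)) ?subrK // => v _.
by rewrite (eq_bigl (pred1 (v `|` b)%O)) ?big_pred1_eq // => u; rewrite /= eq_sym.
Qed.

Lemma push_top_support m u : push_top t m u != 0 ->
  (t u != 0 /\ top_mass t m u != t u) \/
  exists v, u = (v `|` b)%O /\ 0 < top_mass t m v.
Proof.
move=> hu; have [e|ne] := eqVneq (top_mass t m u) (t u); last first.
  left; split=> //; apply: contraNneq ne => tu.
  by rewrite eq_le top_mass_le tu top_mass_ge0.
right; move: hu; rewrite /push_top e subrr add0r => hu.
have /existsP[v /andP[/eqP <- hv]] :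
    [exists v, ((v `|` b)%O == u) && (0 < top_mass t m v)].
  apply: contraNT hu => /existsPn h; rewrite big1 // => v vu.
  by have := h v; rewrite vu /= lt_def top_mass_ge0 andbT negbK => /eqP.
by exists v.
Qed.

Hypothesis t_chain : forall u v, t u != 0 -> t v != 0 -> (u >=< v)%O.
Hypothesis t_A : forall u, t u != 0 -> u \in A.

Lemma top_mass_neq0 m v : 0 < top_mass t m v -> t v != 0.
Proof. by move=> h; rewrite gt_eqF // (lt_le_trans h) // top_mass_le. Qed.

Lemma push_top_A m u : push_top t m u != 0 -> u \in A.
Proof.
case/push_top_support => [[/t_A]//|[v [-> /top_mass_neq0/t_A]]].
exact: joinA.
Qed.

(** The delicate case is an [x] that retains mass and a [y] that has lost some: [top_mass_above]
    rules out [y < x], so [x <= y]. *)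
Lemma push_top_chain m u v : push_top t m u != 0 -> push_top t m v != 0 ->
  (u >=< v)%O.
Proof.
have mixed x y : t x != 0 -> top_mass t m x != t x -> 0 < top_mass t m y ->
    (x <= y `|` b)%O.
  move=> tx nx my; have := t_chain tx (top_mass_neq0 my).
  case/orP => [xy|]; first by rewrite (le_trans xy) // leUl.
  rewrite le_eqVlt => /orP[/eqP <-|yx]; first exact: leUl.
  by rewrite (top_mass_above yx my) eqxx in nx.
move=> /push_top_support[[tu nu]|[x [-> mx]]] /push_top_support[[tv nv]|[y [-> my]]].
- exact: t_chain.
- by rewrite /Order.comparable mixed.
- by rewrite /Order.comparable mixed ?orbT.
have := t_chain (top_mass_neq0 mx) (top_mass_neq0 my).
by case/orP => h; apply/orP; [left|right]; exact: leU2.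
Qed.

Lemma push_top_above m u : 1 <= m -> push_top t m u != 0 -> (b <= u)%O.
Proof.
move=> m1 /push_top_support[[_]|[v [-> _]]]; last exact: leUr.
by rewrite top_mass_full // eqxx.
Qed.

Lemma cone_contract_ge0 s u : 0 <= cone_contract t s u.
Proof.
have /andP[c0 c1] := cone_weight01 s.
by rewrite addr_ge0 // mulr_ge0 ?subr_ge0 ?push_top_ge0 ?ler0n.
Qed.

Lemma cone_contract_sum s : \sum_u cone_contract t s u = 1.
Proof.
rewrite big_split /= -!mulr_sumr push_top_sum mulr1.
rewrite (bigD1 b) //= eqxx big1 ?addr0 ?mulr1 ?subrK // => u ub.
by rewrite (negbTE ub).
Qed.

(** The vertex [b] gains weight only when [2 - 2 * s] is at least [1]. By then all mass sits above
    [b], so adding [b] keeps the support a chain. *)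
Lemma cone_contract_support s u : cone_contract t s u != 0 ->
  (push_top t (2 - 2 * s) u != 0) \/ (u = b /\ 1 <= 2 - 2 * s).
Proof.
have [e|//] := eqVneq (push_top t (2 - 2 * s) u) 0; last by left.
rewrite /cone_contract e mulr0 add0r => h; right.
move: h; case: (u =P b) => [ub|_]; last by rewrite /= mulr0n mulr0 eqxx.
rewrite /= mulr1n mulr1 => c0; split=> //.
have : 0 < cone_weight s by rewrite lt_def c0; case/andP: (cone_weight01 s).
rewrite lt_max ltxx /= lt_min ltr01 /= => h.
by rewrite -[2 in X in _ <= X - _]/(1 + 1) -addrA lerDl ltW.
Qed.

Lemma cone_contract_realization s :
  geometric_realization R (order_complex A) (cone_contract t s).
Proof.
split; [exact: cone_contract_ge0 | exact: cone_contract_sum |].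
rewrite inE; apply/andP; split.
  apply/fintype.subsetP => u; rewrite inE => /cone_contract_support[/push_top_A//|[-> _]//].
apply/forallP => u; apply/implyP; rewrite inE => hu.
apply/forallP => v; apply/implyP; rewrite inE => hv.
case/cone_contract_support: hu => [hu|[-> m1]].
  case/cone_contract_support: hv => [hv|[-> m1]]; first exact: push_top_chain hu hv.
  by rewrite /Order.comparable (push_top_above m1 hu) orbT.
case/cone_contract_support: hv => [hv|[-> _]]; last exact: comparablexx.
by rewrite /Order.comparable (push_top_above m1 hv).
Qed.

Lemma cone_contract_start s u : s <= 0 -> cone_contract t s u = (u == b)%:R.
Proof.
move=> s0; rewrite /cone_contract.
have -> : cone_weight s = 1.
  by rewrite /cone_weight min_l ?max_r ?ler01 // lerBrDr gerDl pmulr_rle0.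
by rewrite subrr mul0r add0r mul1r.
Qed.

Lemma cone_contract_end s u : 1 <= s -> cone_contract t s u = t u.
Proof.
move=> s1; have s2 : 2 <= 2 * s by rewrite ler_peMr.
rewrite /cone_contract.
have -> : cone_weight s = 0.
  rewrite /cone_weight max_l // ge_min subr_le0 (le_trans _ s2) ?orbT //.
  by rewrite ler1n.
rewrite subr0 mul1r mul0r addr0 /push_top top_mass0 ?subr_le0 // subr0.
by rewrite big1 ?addr0 // => v _; rewrite top_mass0 ?subr_le0.
Qed.

End Mass.

Lemma realization_contract (x : X) s :
  cone_contract (set_val x) s \in geometric_realization R (order_complex A).
Proof.
apply/mem_set; have [t0 t1] := set_valP x; rewrite inE => /andP[/fintype.subsetP tA].
move=> /forallP tC; apply: cone_contract_realization => // [u v tu tv|u tu].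
  have /implyP := tC u; rewrite inE => /(_ tu)/forallP/(_ v)/implyP.
  by rewrite inE; apply.
by apply: tA; rewrite inE.
Qed.

Definition realization_cone (z : X * R) : X :=
  exist _ (cone_contract (set_val z.1) z.2) (realization_contract z.1 z.2).

Lemma realization_coord_continuous v :
  continuous (fun z : X * R => set_val z.1 v).
Proof.
have cv (x : X) : {for x, continuous (fun x : X => set_val x v)}.
  exact: (continuous_comp (@set_val_continuous _ _ x) (@ptws_eval_continuous _ _ v _)).
by move=> z; exact: (continuous_comp (@fst_continuous_at _ _ z) (cv _)).
Qed.

Lemma affine_time_continuous (a c : R) :
  continuous (fun z : X * R => a - c * z.2).
Proof.
move=> z; apply: cvgB; first exact: cvg_cst.
by apply: cvgM; [exact: cvg_cst|exact: snd_continuous_at].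
Qed.

Lemma top_mass_continuous v :
  continuous (fun z : X * R => top_mass (set_val z.1) (2 - 2 * z.2) v).
Proof.
move=> z; apply: (@continuous_min R _ (fun z : X * R => set_val z.1 v)
  ((fun=> 0) \max (fun z : X * R =>
     2 - 2 * z.2 - \sum_(w | (v < w)%O) set_val z.1 w))).
  exact: realization_coord_continuous.
apply: continuous_max; first exact: cvg_cst.
apply: cvgB; first exact: affine_time_continuous.
move: z; apply: continuous_big => [|w _]; first exact: add_continuous.
exact: realization_coord_continuous.
Qed.

Lemma cone_weight_continuous : continuous (fun z : X * R => cone_weight z.2).
Proof.
move=> z; apply: (@continuous_max R _ (fun=> 0)
  ((fun=> 1) \min (fun z : X * R => 1 - 2 * z.2))); first exact: cvg_cst.
by apply: continuous_min; [exact: cvg_cst|exact: affine_time_continuous].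
Qed.

Lemma realization_cone_continuous : continuous realization_cone.
Proof.
move=> z; apply: set_type_continuous_at; apply: ptws_continuous_at => u.
apply: cvgD; last first.
  by apply: cvgM; [exact: cone_weight_continuous|exact: cvg_cst].
apply: cvgM.
  by apply: cvgB; [exact: cvg_cst|exact: cone_weight_continuous].
apply: cvgD.
  apply: cvgB; [exact: realization_coord_continuous|exact: top_mass_continuous].
move: z; apply: continuous_big => [|v _]; first exact: add_continuous.
exact: top_mass_continuous.
Qed.

Lemma realization_contractible (x : X) :
  contracting_homotopy (realization_cone (x, 0)) realization_cone.
Proof.
split; first exact: realization_cone_continuous.
- by move=> y s s0; apply: val_inj; apply/funext => u; rewrite /= !cone_contract_start.
- move=> y s s1; apply: val_inj; apply/funext => u.
  by rewrite /= cone_contract_end //; have [] := set_valP y.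
Qed.

Lemma realization_vertex : inhabited X.
Proof.
constructor; exists (fun u => (u == b)%:R : R); apply/mem_set; split.
- by move=> v; exact: ler0n.
- rewrite (bigD1 b) //= eqxx big1 ?addr0 // => u ub.
  by rewrite (negbTE ub).
have -> : [set v | (v == b)%:R != 0 :> R]%SET = [set b]%SET.
  by apply/setP => u; rewrite !inE pnatr_eq0 eqb0 negbK.
rewrite inE finset.sub1set bA; apply/forallP => u; apply/implyP; rewrite inE => /eqP ->.
by apply/forallP => v; apply/implyP; rewrite inE => /eqP ->; exact: comparablexx.
Qed.

End OrderComplexContraction.

Lemma spherical_nucleus_top (R : realType) (d : Order.disp_t)
    (L : finTBLatticeType d) :
  spherical R L -> (nucleus (\top : L) = \bot)%O.
Proof.
move=> [n hn]; apply/eqP; apply: contraT => nuc0.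
set b := nucleus (\top%O : L).
(* [v] lies below some coatom, and every coatom lies above [b]. *)
have below (v : L) : (v < \top)%O -> (v `|` b < \top)%O.
  move=> /exists_lower_cover[c [cc vc]].
  by apply: le_lt_trans (covers_lt cc); rewrite leUx vc nucleus_le.
have bot_top : (\bot < \top :> L)%O.
  by rewrite lt0x; apply: contraNneq nuc0 => e; rewrite -lex0 -e lex1.
have bA : b \in proper_part L.
  by rewrite inE nuc0 -ltx1 -[b]join0x below.
have joinA (v : L) : v \in proper_part L -> (v `|` b)%O \in proper_part L.
  rewrite !inE => /andP[v0 v1]; rewrite -!(ltx1, lt0x) in v0 v1 *.
  by rewrite (lt_le_trans v0 (leUl _ _)) below.
have [x] := realization_vertex R bA.
have := realization_contractible bA joinA x.
move=> /(homotopy_equivalent_contraction hn)[q [G]].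
by move/sphere_not_contractible.
Qed.

Theorem theorem1p4 (R : realType) (d : Order.disp_t) (L : finTBLatticeType d)
    (hsph : spherical R L) (hcu : congruence_uniform L)
    (hint : intersection_property L) (Theta : congruence L) :
  is_lattice (core_label_order (quot Theta)).
Proof.
have cg_inj : {in JI L &, injective (@cgJ d L)} by case: hcu => -[].
apply: core_label_order_lattice.
- exact: quot_cg_inj.
- exact/quot_nucleus_top/spherical_nucleus_top/hsph.
- exact: quot_intersection_property.
Qed.
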